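(* Let $G$ be a finite, simple, connected graph of order $n$ and diameter $2$, and let $G^*$ be its twin graph. Then $\beta(G)=n-3$ if and only if $G^*$, together with the types of its vertices, has one of the following structures: $G_1$: $G^*\cong K_3$ and at most one vertex of $G^*$ is of type (1K). $G_2$: $G^*\cong P_3$ and either (a) the degree-$2$ vertex is of type (N), one leaf is of type (K) and the other leaf is of any type; or (b) one leaf is of type (K), the other leaf is of type (KN), and the degree-$2$ vertex is of any type. $G_3$: $G^*$ is the paw (a triangle with a pendant edge); the degree-$3$ vertex is of any type, one of the degree-$2$ vertices is of type (N), the other degree-$2$ vertex is of type (1K), and the leaf is of type (1N); moreover, if a degree-$2$ vertex is of type (K), then neither the leaf nor the degree-$3$ vertex is of type (N). $G_4$: $G^*\cong C_5$ and every vertex is of type (1). $G_5$: $G^*$ is $C_5$ with one chord; the two adjacent degree-$2$ vertices are of type (1) and the other three vertices are of type (1K). $G_6$: $G^*$ is $C_5$ with two chords sharing an endpoint (so one vertex has degree $4$); the degree-$4$ vertex is of any type and all other vertices are of type (1K); furthermore, no two non-adjacent vertices are both of type (K), and no two adjacent vertices are such that one is of type (K) and the other of type (N). $G_7$: $G^*$ is the kite ($K_4$ minus an edge) with a pendant edge attached to one of its degree-$3$ vertices; the leaf is of type (1), the degree-$4$ vertex and the (remaining) degree-$3$ vertex are of type (1K), and of the two degree-$2$ vertices one is of type (K) and the other of type (1). $G_8$: $G^*$ is the kite; of the two degree-$2$ vertices one is of type (K) and the other of type (1), and of the two degree-$3$ vertices one is of type (N) and the other of type (1K). $G_9$: $G^*\cong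 C_4$, two adjacent vertices are of type (K), and the other two are of type (1). $G_{10}$: $G^*\cong C_4\vee K_1$; two adjacent degree-$3$ vertices are of type (K), the degree-$4$ vertex is of type (1K), and the remaining two vertices are of type (1).
   Context: For an ordered set $W=\{w_1,\dots,w_k\}$ of vertices of a connected graph $G$ and a vertex $v$, $r(v|W)=(d(v,w_1),\dots,d(v,w_k))$, where $d$ is the shortest-path distance. $W$ is a resolving set if distinct vertices have distinct vectors $r(\cdot|W)$; the metric dimension $\beta(G)$ is the minimum size of a resolving set. Two distinct vertices $u,v$ are twins if $N(v)\setminus\{u\}=N(u)\setminus\{v\}$ (open neighbourhoods); $u\equiv v$ iff $u=v$ or $u,v$ are twins; this is an equivalence relation, and the class of $v$ is denoted $v^*$. The twin graph $G^*$ has vertex set $\{v^*: v\in V(G)\}$, with $u^*v^*$ an edge iff $uv\in E(G)$ (well defined). Each class $v^*$ induces a complete or an empty graph. A vertex $v^*$ of $G^*$ is of type (1) if $|v^*|=1$, of type (K) if $G[v^*]\cong K_r$ with $r\ge 2$, and of type (N) if $G[v^*]$ is the edgeless graph on $r\ge 2$ vertices. Type (1K) means type (1) or (K); (1N) means (1) or (N); (KN) means (K) or (N). The paw is a triangle with one pendant edge; the kite is $K_4$ minus one edge; $\vee$ denotes the join. *)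

(* Defs.v *)
From mathcomp Require Import all_boot.
Set Implicit Arguments. Unset Strict Implicit. Unset Printing Implicit Defensive.

Section Graph.
Variables (T : finType) (e : rel T).

(* A graph is a symmetric irreflexive relation e on a finite type T. *)

Fixpoint ball (n : nat) (u : T) : {set T} :=
  match n with
  | 0 => [set u]
  | n'.+1 => ball n' u :|: [set y | [exists x in ball n' u, e x y]]
  end.

(* shortest-path distance: least n with v in ball n u (all distances in a
   connected graph are < #|T|, so the search range iota 0 #|T| suffices) *)
Definition dist (u v : T) : nat := find (fun n => v \in ball n u) (iota 0 #|T|).

Definition diameter : nat := \max_(p : T * T) dist p.1 p.2.

Definition resolving (W : {set T}) : bool :=
  [forall u, forall v, [forall w in W, dist u w == dist v w] ==> (u == v)].

(* metric dimension: minimum size of a resolving set (setT is resolving) *)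
Definition metric_dim : nat :=
  \big[minn/#|T|]_(W : {set T} | resolving W) #|W|.

Definition nbhd (v : T) : {set T} := [set x | e v x].

Definition twin_eq (u v : T) : bool :=
  (u == v) || (nbhd v :\ u == nbhd u :\ v).

Definition twin_class (v : T) : {set T} := [set u | twin_eq u v].

Definition twin_vertices : {set {set T}} := [set twin_class v | v : T].

Definition twin_adj (A B : {set T}) : bool :=
  (A != B) && [exists u in A, exists v in B, e u v].

Definition typ1 (A : {set T}) : bool := #|A| == 1.
Definition typK (A : {set T}) : bool :=
  (1 < #|A|) && [forall u in A, forall v in A, (u != v) ==> e u v].
Definition typN (A : {set T}) : bool :=
  (1 < #|A|) && [forall u in A, forall v in A, ~~ e u v].
Definition typ1K A := typ1 A || typK A.
Definition typ1N A := typ1 A || typN A.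
Definition typKN A := typK A || typN A.

Definition twin_iso (k : nat) (H : rel 'I_k) (phi : 'I_k -> {set T}) : Prop :=
  [/\ injective phi,
      [set phi i | i : 'I_k] = twin_vertices &
      forall i j, H i j = twin_adj (phi i) (phi j)].

End Graph.

Definition tmpl (k : nat) (E : seq (nat * nat)) : rel 'I_k :=
  fun i j => ((val i, val j) \in E) || ((val j, val i) \in E).

Definition K3 : rel 'I_3 := tmpl [:: (0,1); (1,2); (0,2)].
Definition P3 : rel 'I_3 := tmpl [:: (0,1); (1,2)].
Definition paw : rel 'I_4 := tmpl [:: (0,1); (1,2); (0,2); (0,3)].
Definition C5 : rel 'I_5 := tmpl [:: (0,1); (1,2); (2,3); (3,4); (4,0)].
Definition C5c1 : rel 'I_5 :=
  tmpl [:: (0,1); (1,2); (2,3); (3,4); (4,0); (0,2)].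
Definition C5c2 : rel 'I_5 :=
  tmpl [:: (0,1); (1,2); (2,3); (3,4); (4,0); (0,2); (0,3)].
Definition kite : rel 'I_4 := tmpl [:: (0,1); (0,2); (0,3); (1,2); (1,3)].
Definition kite_pend : rel 'I_5 :=
  tmpl [:: (0,1); (0,2); (0,3); (1,2); (1,3); (0,4)].
Definition C4 : rel 'I_4 := tmpl [:: (0,1); (1,2); (2,3); (3,0)].
Definition C4K1 : rel 'I_5 :=
  tmpl [:: (0,1); (1,2); (2,3); (3,0); (0,4); (1,4); (2,4); (3,4)].

Section Structures.
Variables (T : finType) (e : rel T).
Notation t1 := (typ1 (T:=T)).
Notation tK := (typK e).
Notation tN := (typN e).
Notation t1K := (typ1K e).
Notation t1N := (typ1N e).
Notation tKN := (typKN e).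

Definition struct_G1 : Prop := exists phi : 'I_3 -> {set T},
  twin_iso e K3 phi /\ #|[set i : 'I_3 | t1K (phi i)]| <= 1.

Definition struct_G2 : Prop := exists phi : 'I_3 -> {set T},
  twin_iso e P3 phi /\
  ((tN (phi (inord 1)) /\ tK (phi (inord 0))) \/
   (tK (phi (inord 0)) /\ tKN (phi (inord 2)))).

Definition struct_G3 : Prop := exists phi : 'I_4 -> {set T},
  twin_iso e paw phi /\
  [/\ tN (phi (inord 1)), t1K (phi (inord 2)), t1N (phi (inord 3)) &
      (tK (phi (inord 1)) || tK (phi (inord 2))) ->
        ~~ tN (phi (inord 3)) /\ ~~ tN (phi (inord 0))].

Definition struct_G4 : Prop := exists phi : 'I_5 -> {set T},
  twin_iso e C5 phi /\ forall i, t1 (phi i).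

Definition struct_G5 : Prop := exists phi : 'I_5 -> {set T},
  twin_iso e C5c1 phi /\
  [/\ t1 (phi (inord 3)), t1 (phi (inord 4)),
      t1K (phi (inord 0)), t1K (phi (inord 1)) & t1K (phi (inord 2))].

Definition struct_G6 : Prop := exists phi : 'I_5 -> {set T},
  twin_iso e C5c2 phi /\
  [/\ forall i : 'I_5, i != inord 0 -> t1K (phi i),
      forall i j : 'I_5, i != j -> ~~ C5c2 i j -> ~~ (tK (phi i) && tK (phi j)) &
      forall i j : 'I_5, C5c2 i j -> ~~ (tK (phi i) && tN (phi j))].

Definition struct_G7 : Prop := exists phi : 'I_5 -> {set T},
  twin_iso e kite_pend phi /\
  [/\ t1 (phi (inord 4)), t1K (phi (inord 0)), t1K (phi (inord 1)),
      tK (phi (inord 2)) & t1 (phi (inord 3))].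

Definition struct_G8 : Prop := exists phi : 'I_4 -> {set T},
  twin_iso e kite phi /\
  [/\ tK (phi (inord 2)), t1 (phi (inord 3)),
      tN (phi (inord 0)) & t1K (phi (inord 1))].

Definition struct_G9 : Prop := exists phi : 'I_4 -> {set T},
  twin_iso e C4 phi /\
  [/\ tK (phi (inord 0)), tK (phi (inord 1)),
      t1 (phi (inord 2)) & t1 (phi (inord 3))].

Definition struct_G10 : Prop := exists phi : 'I_5 -> {set T},
  twin_iso e C4K1 phi /\
  [/\ tK (phi (inord 0)), tK (phi (inord 1)), t1K (phi (inord 4)),
      t1 (phi (inord 2)) & t1 (phi (inord 3))].

End Structures.

(* Main.v *)
Require Import Defs.
From Corelib Require Import Setoid.
From mathcomp Require Import all_boot.
Set Implicit Arguments. Unset Strict Implicit. Unset Printing Implicit Defensive.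

(* In diameter two a set is resolving iff its complement U is such that any two
   vertices of U are told apart, by adjacency alone, by some vertex outside U.
   Hence beta(G) = n - 3 iff there is such a U ("good" below) of size 3 and none
   of size 4.

   Let w1, w2 tell the vertices of {a, b, c} apart.  As no good set of size 4
   exists, every further vertex has the (w1, w2)-code of a, b or c, and two
   vertices of equal code can only be told apart by a vertex that is alone with
   its own code.  This leaves at most seven vertex classes in an explicit
   pattern, and a finite check shows that G has at most five twin classes.  What
   then matters is the twin graph with its types, a finite object: all of them
   on at most five vertices are enumerated and compared with the structures
   G_1, ..., G_10. *)

(** * Twins and good sets *)

(** No third vertex tells two twins apart, so a good set meets each twin class at most once, and
    whether one of a given size exists depends only on the twin graph with its types. A type other
    than (1) matters twice: the class keeps a vertex outside the set, and type (K) makes the class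
    adjacent to itself. This is what makes the problem computable. The obstacle is the pattern with
    seven cells. Its three cells coded like [a] are not known to be twin classes, so it bounds
    nothing yet, and seven vertices leave up to 21 adjacencies to guess. But in this pattern [b] and
    [c] separate [a1], [a2], [a3], so the case analysis can be repeated with [b], [c] in the role of
    [w1], [w2]. A second seven-cell pattern on top of the first is so rigid that a short enumeration
    finds a good set of size 4 inside it. The typed enumerations rely on one monotonicity: a good
    set survives when classes grow, so a partial assignment of types that already has a good set of
    size 4 is discarded at once. *)

Lemma pairwise_in (A : eqType) (r : rel A) s :
  uniq s -> {in s &, forall x y, x != y -> r x y} -> pairwise r s.
Proof.
elim: s => //= x s IHs /andP[x_s s_uniq] rs; apply/andP; split.
  apply/allP=> y ys; apply: rs; rewrite ?inE ?eqxx ?ys ?orbT //.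
  by apply: contraNneq x_s => ->.
by apply: IHs => // y z ys zs; apply: rs; rewrite inE ?ys ?zs orbT.
Qed.

Lemma in_pairwise (A : eqType) (r : rel A) s : symmetric r ->
  pairwise r s -> {in s &, forall x y, x != y -> r x y}.
Proof.
move=> r_sym; elim: s => //= z s IHs /andP[/allP rz /IHs rs] x y.
rewrite !inE => /orP[/eqP->|xs] /orP[/eqP->|ys]; first by rewrite eqxx.
- by move=> _; apply: rz.
- by move=> _; rewrite r_sym; apply: rz.
- exact: rs.
Qed.

Section Twins.
Variables (T : finType) (e : rel T).
Hypotheses (e_sym : symmetric e) (e_irr : irreflexive e).
Implicit Types (x y z u v : T) (S R c : seq T).
Notation twin := (twin_eq e).

Lemma twinP x y :
  reflect (forall z, z != x -> z != y -> e z x = e z y) (twin x y).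
Proof.
apply: (iffP orP) => [[/eqP->//|/eqP/setP exy] z zx zy | exy].
  by have := exy z; rewrite !inE zx zy /= => ezxy; rewrite e_sym -ezxy e_sym.
have [->|xy] := eqVneq x y; [by left | right].
apply/eqP/setP=> z; rewrite !inE.
have [->|zx] /= := eqVneq z x; first by rewrite e_irr andbF.
have [->|zy] /= := eqVneq z y; first by rewrite e_irr.
by rewrite e_sym [e x z]e_sym exy.
Qed.

Lemma twin_refl : reflexive twin. Proof. by move=> x; rewrite /twin_eq eqxx. Qed.

Lemma twin_sym : symmetric twin.
Proof. by move=> x y; apply/twinP/twinP => exy z zx zy; rewrite exy. Qed.

Lemma twin_trans : transitive twin.
Proof.
move=> y x z; have [->//|xy] := eqVneq x y; have [->//|yz] := eqVneq y z.
have [->|xz] := eqVneq x z; first by rewrite twin_refl.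
move=> /twinP exy /twinP eyz; apply/twinP => v vx vz.
have [->|vy] := eqVneq v y; last by rewrite exy ?eyz.
by rewrite e_sym eyz // e_sym exy 1?eq_sym // e_sym.
Qed.

Lemma twin_classE x y : (twin_class e x == twin_class e y) = twin x y.
Proof.
apply/eqP/idP => [/setP/(_ x)|xy]; first by rewrite !inE twin_refl.
apply/setP=> z; rewrite !inE; apply/idP/idP => zz; apply: twin_trans zz _ => //.
by rewrite twin_sym.
Qed.

Lemma not_twin x y : ~~ twin x y -> exists z, [/\ z != x, z != y & e z x != e z y].
Proof.
move=> xy; case: (pickP (fun z => [&& z != x, z != y & e z x != e z y])).
  by move=> z /and3P[]; exists z.
move=> nz; case/twinP: xy => z zx zy; apply/eqP.
by have := nz z; rewrite /= zx zy /= => /negbFE.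
Qed.

(* [None] is type (1), [Some true] type (K), [Some false] type (N). *)
Definition class_type x : option bool :=
  if [pick y | (y != x) && twin x y] is Some y then Some (e x y) else None.

Lemma class_typeP x y : y != x -> twin x y -> class_type x = Some (e x y).
Proof.
move=> yx xy; rewrite /class_type; case: pickP => [z /andP[zx xz]|/(_ y)].
  congr Some; have [->//|zy] := eqVneq z y; apply/twinP; rewrite 1?eq_sym //.
  by apply: twin_trans xy; rewrite twin_sym.
by rewrite yx xy.
Qed.

Lemma class_type_mate x : class_type x -> exists2 y, y != x & twin x y.
Proof. by rewrite /class_type; case: pickP => // y /andP[]; exists y. Qed.

Lemma class_type_twin x y : twin x y -> class_type x = class_type y.
Proof.
have [->//|xy txy] := eqVneq x y.
rewrite (class_typeP _ txy) 1?eq_sym // (@class_typeP y x) 1?e_sym //.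
by rewrite twin_sym.
Qed.

Lemma typ1E x : typ1 (twin_class e x) = (class_type x == None).
Proof.
apply/idP/eqP => [/cards1P[a ea]|ex].
  rewrite /class_type; case: pickP => // y /andP[yx xy].
  have: x \in twin_class e x by rewrite inE twin_refl.
  have: y \in twin_class e x by rewrite inE twin_sym.
  by rewrite ea !inE => /eqP ya /eqP xa; rewrite ya xa eqxx in yx.
apply/cards1P; exists x; apply/setP=> y; rewrite !inE.
apply/idP/eqP => [yx|->]; last exact: twin_refl.
apply/eqP; case: (eqVneq y x) => // nyx.
by rewrite twin_sym in yx; rewrite (class_typeP nyx yx) in ex.
Qed.

Lemma class_big x : (1 < #|twin_class e x|) = class_type x.
Proof.
have: (#|twin_class e x| == 1) = (class_type x == None) := typ1E x.
have: 0 < #|twin_class e x| by apply/card_gt0P; exists x; rewrite inE twin_refl.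
by case: #|_| => [|[|n]] //; case: class_type.
Qed.

Lemma class_adj x y z : twin y x -> twin z x -> y != z ->
  class_type x = Some (e y z).
Proof.
move=> yx zx yz; rewrite -(class_type_twin yx); apply: class_typeP; rewrite 1?eq_sym //.
by apply: twin_trans yx _; rewrite twin_sym.
Qed.

Lemma typKE x : typK e (twin_class e x) = (class_type x == Some true).
Proof.
rewrite /typK class_big; apply/andP/eqP => [[b /forall_inP ee]|ex].
  have [y yx xy] := class_type_mate b.
  rewrite (class_typeP yx xy); congr Some.
  have xx : x \in twin_class e x by rewrite inE twin_refl.
  have/forall_inP/(_ y) := ee x xx; rewrite inE twin_sym xy eq_sym yx.
  by move=> /(_ isT) /= ->.
split; first by rewrite ex.
apply/forall_inP=> y; rewrite inE => yx; apply/forall_inP=> z; rewrite inE => zx.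
by apply/implyP => yz; have := class_adj yx zx yz; rewrite ex => -[<-].
Qed.

Lemma typNE x : typN e (twin_class e x) = (class_type x == Some false).
Proof.
rewrite /typN class_big; apply/andP/eqP => [[b /forall_inP ee]|ex].
  have [y yx xy] := class_type_mate b.
  rewrite (class_typeP yx xy); congr Some; apply: negbTE.
  have xx : x \in twin_class e x by rewrite inE twin_refl.
  by have/forall_inP/(_ y) := ee x xx; rewrite inE twin_sym xy; apply.
split; first by rewrite ex.
apply/forall_inP=> y; rewrite inE => yx; apply/forall_inP=> z; rewrite inE => zx.
have [->|yz] := eqVneq y z; first by rewrite e_irr.
by have := class_adj yx zx yz; rewrite ex => -[<-].
Qed.

(** * Systems of representatives of the twin classes *)

Definition covers R := [forall v, has (twin v) R].

Definition twin_transversal c :=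
  [/\ uniq c, {in c &, forall x y, x != y -> ~~ twin x y} & covers c].

Lemma coversP R : reflect (forall v, exists2 x, x \in R & twin v x) (covers R).
Proof. by apply: (iffP forallP) => H v; apply/hasP; apply: H. Qed.

Lemma perm_twin_transversal c c' : perm_eq c c' ->
  twin_transversal c -> twin_transversal c'.
Proof.
move=> cc' [c_uniq c_tw /coversP c_cov]; have cc := perm_mem cc'.
split; first by rewrite -(perm_uniq cc').
  by move=> x y; rewrite -!cc; apply: c_tw.
by apply/coversP => v; have [x xc vx] := c_cov v; exists x; rewrite -?cc.
Qed.

Lemma covers_twin_transversal R : covers R ->
  twin_transversal R \/ exists2 c, twin_transversal c & size c < size R.
Proof.
have [n] := ubnP (size R); elim: n R => // n IHn R ltRn /coversP covR.
have [R_tw|] := boolP (pairwise (fun x y => ~~ twin x y) R).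
  left; split; [| |exact/coversP].
    by apply: pairwise_uniq R_tw => x; rewrite twin_refl.
  by apply: in_pairwise R_tw => x y; rewrite twin_sym.
move=> R_tw; right.
have [R' covR' ltR'] : exists2 R', covers R' & size R' < size R.
  have [R_uniq|R_uniq] := boolP (uniq R); last first.
    exists (undup R); last by rewrite ltn_size_undup.
    by apply/coversP=> v; have [x xR vx] := covR v; exists x; rewrite ?mem_undup.
  have /existsP[x /existsP[y /and4P[xR yR xy txy]]] :
    [exists x, exists y, [&& x \in R, y \in R, x != y & twin x y]].
    apply: contraNT R_tw => /existsPn nR; apply: pairwise_in => // x y xR yR xy.
    by have /existsPn/(_ y) := nR x; rewrite xR yR xy.
  exists (rem y R); last by rewrite size_rem // prednK //; case: (R) yR.
  apply/coversP=> v; have [z zR vz] := covR v.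
  have [zy|zy] := eqVneq z y; last by exists z => //; rewrite mem_rem_uniq // !inE zy.
  exists x; first by rewrite mem_rem_uniq // !inE xy.
  by apply: twin_trans vz _; rewrite zy twin_sym.
have [|c_tr|[c c_tr ltc]] := IHn R' _ covR'.
- exact: leq_trans ltR' _.
- by exists R'.
- by exists c => //; apply: ltn_trans ltR'.
Qed.

(* In diameter two, [good S] says that the complement of [S] is resolving. *)
Definition sep S : rel T := fun x y => [exists z, (z \notin S) && (e z x != e z y)].
Definition good S := pairwise (sep S) S.
Definition pack s := exists2 S, size S = s & good S.

Lemma sepI S x y z : z \notin S -> e z x != e z y -> sep S x y.
Proof. by move=> zS ezxy; apply/existsP; exists z; rewrite zS. Qed.

Lemma sep_sym S : symmetric (sep S).
Proof. by move=> x y; apply: eq_existsb => z; rewrite eq_sym. Qed.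

Lemma sep_irr S : irreflexive (sep S).
Proof. by move=> x; apply/existsP => -[z]; rewrite eqxx andbF. Qed.

Lemma good_uniq S : good S -> uniq S.
Proof. exact/pairwise_uniq/sep_irr. Qed.

End Twins.

(** * Typed twin graphs as computational objects *)

(* [has], [all] and [pairwise] are strict under call by value; these
   short-circuiting variants keep the computations below small. *)
Section Lazy.
Variable A : Type.
Fixpoint anyb (a : pred A) s :=
  if s is x :: s' then if a x then true else anyb a s' else false.
Fixpoint allb (a : pred A) s :=
  if s is x :: s' then if a x then allb a s' else false else true.
Fixpoint pairb (r : rel A) s :=
  if s is x :: s' then if allb (r x) s' then pairb r s' else false else true.

Lemma anybE a s : anyb a s = has a s.
Proof. by elim: s => //= x s ->; case: (a x). Qed.
Lemma allbE a s : allb a s = all a s.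
Proof. by elim: s => //= x s ->; case: (a x). Qed.
Lemma pairbE r s : pairb r s = pairwise r s.
Proof. by elim: s => //= x s ->; rewrite allbE; case: (all _ _). Qed.

Fixpoint subs (k : nat) (s : seq A) : seq (seq A) :=
  match k, s with
  | 0, _ => [:: [::]]
  | _.+1, [::] => [::]
  | k'.+1, x :: s' => [seq x :: r | r <- subs k' s'] ++ subs k s'
  end.

Fixpoint words (s : seq A) (k : nat) : seq (seq A) :=
  if k is k'.+1 then [seq x :: w | x <- s, w <- words s k'] else [:: [::]].
End Lazy.

Lemma subsP (A : eqType) (s r : seq A) k : uniq s ->
  r \in subs k s -> [/\ uniq r, size r = k & {subset r <= s}].
Proof.
elim: s k r => [|x s IHs] [|k] r //=.
- by rewrite inE => _ /eqP->.
- by rewrite inE => _ /eqP->; split.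
move=> /andP[xs s_uniq]; have {}IHs k' r' := IHs k' r' s_uniq.
rewrite mem_cat => /orP[/mapP[r' /IHs[r'_uniq r'_size r's] ->]|/IHs[r_uniq r_size rs]].
  split=> /= [||y]; rewrite ?r'_size // ?r'_uniq ?andbT.
    by apply: contra xs => /r's.
  by rewrite !inE => /orP[->//|/r's->]; rewrite orbT.
by split=> // y /rs ys; rewrite inE ys orbT.
Qed.

Lemma subseq_subs (A : eqType) (s r : seq A) : subseq r s -> r \in subs (size r) s.
Proof.
elim: s r => [|x s IHs] [|y r] //=; case: eqP => [->|_] rs.
  by rewrite mem_cat; apply/orP; left; apply: map_f; apply: IHs.
by rewrite mem_cat; apply/orP; right; apply: (IHs (y :: r)).
Qed.

Lemma wordsP (A : eqType) (s w : seq A) : {subset w <= s} -> w \in words s (size w).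
Proof.
elim: w => //= x w IHw sub; apply/allpairsP; exists (x, w); split=> //=.
  by rewrite sub ?mem_head.
by apply: IHw => y yw; rewrite sub // inE yw orbT.
Qed.

Lemma bitseq_words (w : bitseq) : w \in words [:: true; false] (size w).
Proof. by apply: wordsP => -[]. Qed.

Definition ctypes := [:: None; Some true; Some false].

Lemma mem_ctypes x : x \in ctypes. Proof. by case: x => [[]|]. Qed.

(* [H] is the twin graph of a graph on the classes [0 .. size t - 1] and [t] lists
   their types, as given by [class_type].  Class
   [z] has a vertex outside a set of representatives of the classes in [S] iff it
   is not in [S] or has two vertices, so [csep S] mirrors separation in the graph. *)
Section Quotient.
Variables (H : rel nat) (t : seq (option bool)).

(** The diagonal stands for two different members of one class, which are adjacent exactly for type
    (K). *)
Definition link : rel nat :=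
  fun i j => if i == j then nth None t i == Some true else H i j.
Definition csep (S : seq nat) : rel nat := fun i j =>
  anyb (fun z => if link z i == link z j then false else
                 if z \in S then nth None t z : bool else true)
       (iota 0 (size t)).
Definition cgood S := pairb (csep S) S.
Definition cpack s := anyb cgood (subs s (iota 0 (size t))).
(** Different classes must not merge: they are told apart by a vertex other than the two
    representatives, possibly by a second member of class [i] or [j]. *)
Definition creduced :=
  pairb (fun i j => csep [:: i; j] i j) (iota 0 (size t)).
(** Two members of one class have the same neighbours outside it, so for type (N) a single neighbour
    of the class already joins them. *)
Definition cdiam2 := let ks := iota 0 (size t) in
  allb (fun i => allb (fun j =>
    if i == j then if nth None t i then link i i || anyb (link^~ i) ks else true
    else if H i j then true else
      anyb (fun z => if link z i then link z j else false) ks) ks) ks.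

Lemma csepP S i j : reflect
  (exists z, [/\ z < size t, link z i != link z j & (z \notin S) || nth None t z])
  (csep S i j).
Proof.
rewrite /csep anybE; apply: (iffP hasP) => -[z].
  rewrite mem_iota => zt; case: eqVneq => // lz zS; exists z; split=> //.
  by case: (z \in S) zS.
move=> [zt lz zS]; exists z; first by rewrite mem_iota.
by rewrite (negbTE lz); case: (z \in S) zS.
Qed.

Lemma csep_sym S : symmetric (csep S).
Proof. by move=> i j; apply/csepP/csepP => -[z [? ?]]; exists z; rewrite eq_sym. Qed.

Lemma csep_irr S : irreflexive (csep S).
Proof. by move=> i; apply/csepP => -[z []]; rewrite eqxx. Qed.
End Quotient.

(* Enlarging classes preserves separation, so a tree search over the types of
   the classes may be pruned at partial assignments completed by [None]. *)
Lemma cpack_mono H t t' s : size t = size t' ->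
  (forall i, nth None t i = None \/ nth None t i = nth None t' i) ->
  cpack H t s -> cpack H t' s.
Proof.
move=> tt' le_t; rewrite /cpack !anybE tt' => /hasP[S S_sub S_good].
apply/hasP; exists S => //; move: S_good; rewrite /cgood !pairbE.
move=> S_good; have S_uniq := pairwise_uniq (csep_irr H t S) S_good.
have := S_good; apply: (sub_in_pairwise (P := mem S)); last by apply/allP.
move=> i j iS jS /csepP[z [zt lz zS]]; apply/csepP; exists z; split.
- by rewrite -tt'.
(* Only the diagonal of [link] depends on the types. If [z] lies in [S], it separates only by having
   two members already, and then its type is the same in [t']. *)
- have lE k : k \in S -> link H t' z k = link H t z k.
    rewrite /link; case: eqP => // <- zk; rewrite zk /= in zS.
    by have [E|->//] := le_t z; rewrite E in zS.
  by rewrite !lE.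
- by have [E|<-//] := le_t z; move: zS; rewrite E orbF => ->.
Qed.

Fixpoint search (H : rel nat) (P : pred (seq (option bool))) n pre :=
  if cpack H (pre ++ nseq n None) 4 then true else
  if n is n'.+1 then allb (fun x => search H P n' (rcons pre x)) ctypes else
  if ~~ creduced H pre then true else if ~~ cdiam2 H pre then true else P pre.

Lemma searchP H P t : ~~ cpack H t 4 -> creduced H t -> cdiam2 H t ->
  search H P (size t) [::] -> P t.
Proof.
move=> no4 red diam; suff: forall r pre, pre ++ r = t ->
  search H P (size r) pre -> P t by move/(_ t [::] erefl).
elim=> [|x r IHr] pre /=.
  by rewrite !cats0 => ->; rewrite (negbTE no4) red diam.
move=> rt; case: ifP => [p4|_].
  case/negP: no4; rewrite -rt; apply: cpack_mono p4.
    by rewrite !size_cat /= size_nseq.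
  move=> i; rewrite !nth_cat -[None :: _]/(nseq (size r).+1 None) nth_nseq if_same.
  by case: ifP; [right | left].
rewrite -[if _ then _ else _]/
  (allb (fun x => search H P (size r) (rcons pre x)) ctypes).
by rewrite allbE => /allP/(_ x (mem_ctypes x)); apply: IHr; rewrite cat_rcons.
Qed.

(** * Reduction to the typed twin graph *)

Section Bridge.
Variables (T : finType) (e : rel T) (x0 : T) (H : rel nat) (c : seq T).
Hypotheses (e_sym : symmetric e) (e_irr : irreflexive e).
Hypothesis c_tr : twin_transversal e c.
Hypothesis HE : forall i j, i < size c -> j < size c -> i != j ->
  H i j = e (nth x0 c i) (nth x0 c j).
Notation twin := (twin_eq e).
Notation t := (map (class_type e) c).
Notation r := (nth x0 c).

Definition cell v := find (twin v) c.

Lemma cell_lt v : cell v < size c.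
Proof. by have [_ _ /forallP/(_ v)] := c_tr; rewrite has_find. Qed.

Lemma cell_twin v : twin v (r (cell v)).
Proof. by have [_ _ /forallP/(_ v)] := c_tr; apply: nth_find. Qed.

Lemma cell_uniq v i : i < size c -> twin v (r i) -> cell v = i.
Proof.
move=> ic vi; have [c_uniq c_tw _] := c_tr; apply/eqP.
rewrite -(nth_uniq x0 _ ic c_uniq) ?cell_lt //; apply/negP => /negP ne.
case/negP: (c_tw _ _ (mem_nth x0 (cell_lt v)) (mem_nth x0 ic) ne).
by apply: twin_trans vi => //; rewrite twin_sym ?cell_twin.
Qed.

Lemma cell_nth i : i < size c -> cell (r i) = i.
Proof. by move=> ic; apply: cell_uniq => //; apply: twin_refl. Qed.

Lemma eq_cell u v : (cell u == cell v) = twin u v.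
Proof.
apply/eqP/idP => [uv|uv].
  apply: twin_trans (cell_twin u) _ => //.
  by rewrite uv twin_sym // cell_twin.
by apply: cell_uniq (cell_lt v) _; apply: twin_trans uv (cell_twin v).
Qed.

Lemma nth_class_type v : nth None t (cell v) = class_type e v.
Proof.
by rewrite (nth_map x0) ?cell_lt // -(class_type_twin e_sym e_irr (cell_twin v)).
Qed.

(** Inside a class adjacency is given by the type; across two classes each end is exchanged for its
    representative in turn. *)
Lemma linkE u v : u != v -> link H t (cell u) (cell v) = e u v.
Proof.
move=> uv; rewrite /link eq_cell; have [tuv|ntuv] := boolP (twin u v).
  rewrite nth_class_type (class_typeP e_sym e_irr _ tuv) 1?eq_sym //.
have cuv : cell u != cell v by rewrite eq_cell.
rewrite HE ?cell_lt //; set x := r _; set y := r _.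
have /(twinP e_sym e_irr) ux := cell_twin u.
have /(twinP e_sym e_irr) vy := cell_twin v.
have uy : u != y by apply: contraNneq cuv => ->; rewrite cell_nth ?cell_lt.
have xy : x != y.
  apply: contraNneq cuv => xy.
  by rewrite -(cell_nth (cell_lt u)) -/x xy cell_nth ?cell_lt.
by rewrite vy // ![e _ y]e_sym ux // eq_sym.
Qed.

Lemma sep_csep S u v : u \in S -> v \in S ->
  sep e S u v -> csep H t (map cell S) (cell u) (cell v).
Proof.
move=> uS vS /existsP[z /andP[zS ezuv]]; apply/csepP; exists (cell z).
have zN w : w \in S -> z != w by apply: contraTneq => <-.
rewrite size_map cell_lt !linkE ?zN //; split=> //; rewrite -implyNb negbK.
(* If the class of the separator [z] meets [S], it has two members, [z] and [s]. *)
apply/implyP => /mapP[s sS zs]; rewrite nth_class_type.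
have /eqP := zs; rewrite eq_cell => zts.
by rewrite (class_typeP e_sym e_irr _ zts) // eq_sym zN.
Qed.

Lemma csep_sep q i j : {subset q <= iota 0 (size c)} -> i \in q -> j \in q ->
  csep H t q i j -> sep e (map r q) (r i) (r j).
Proof.
move=> q_lt iq jq /csepP[z [zt lz zq]]; rewrite size_map in zt.
have lt_q k : k \in q -> k < size c by move/q_lt; rewrite mem_iota.
(* If [z] is in [q] its representative is taken, but its type then provides a second member of the
   class. *)
have [w wz wq] : exists2 w, cell w = z & w \notin map r q.
  case/orP: zq => [zq|].
    exists (r z); first exact: cell_nth.
    apply: contra zq => /mapP[k kq]; move/(congr1 cell).
    by rewrite (cell_nth zt) (cell_nth (lt_q _ kq)) => ->.
  rewrite (nth_map x0) // => /class_type_mate[w wz zw].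
  have cwz : cell w = z by apply: cell_uniq => //; rewrite twin_sym.
  exists w => //; apply: contra wz => /mapP[k kq wk].
  by rewrite -cwz wk (cell_nth (lt_q _ kq)).
have wN k : k \in q -> w != r k by move=> kq; apply: contraNneq wq => ->; apply: map_f.
by apply: (sepI wq); rewrite -!linkE ?wN // wz !cell_nth ?lt_q.
Qed.

(** Twins are never separated ([csep_irr] on cells), so [cell] is injective on a good set, and its
    vertices may be replaced by the representatives of their classes. *)
Lemma packE s : cpack H t s <-> pack e s.
Proof.
rewrite /cpack anybE size_map; split.
  move=> /hasP[q /(subsP (iota_uniq _ _))[q_uniq q_size q_lt]].
  rewrite /cgood pairbE => q_good; exists (map r q); first by rewrite size_map.
  apply: pairwise_in.
    rewrite map_inj_in_uniq // => i j /q_lt; rewrite mem_iota => ic /q_lt.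
    by rewrite mem_iota => jc /(congr1 cell); rewrite !cell_nth.
  move=> _ _ /mapP[i iq ->] /mapP[j jq ->] ij; apply: csep_sep => //.
  apply: (in_pairwise (@csep_sym _ _ _) q_good) => //.
  by apply: contraNneq ij => ->.
move=> [S S_size S_good]; have S_uniq := good_uniq S_good.
have S_sep : {in S &, forall u v, u != v -> csep H t (map cell S) (cell u) (cell v)}.
  move=> u v uS vS uv; apply: sep_csep => //.
  by apply: in_pairwise S_good _ _ uS vS uv; apply: sep_sym.
have inj : {in S &, injective cell}.
  move=> u v uS vS uv; have := S_sep u v uS vS; rewrite uv csep_irr.
  by case: eqVneq => // _ /(_ isT).
(* [subs] lists increasing sequences only, so the cells of [S] are sorted. *)
pose q := [seq i <- iota 0 (size c) | i \in map cell S].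
have q_uniq : uniq q by rewrite filter_uniq ?iota_uniq.
have mem_q : q =i map cell S.
  move=> i; rewrite mem_filter mem_iota; case iS: (i \in _) => //=.
  by have /mapP[u _ ->] := iS; rewrite cell_lt.
have q_size : size q = s.
  rewrite -S_size -(size_map cell S); apply/eqP.
  rewrite eq_sym -(uniq_size_uniq q_uniq) //.
  by rewrite map_inj_in_uniq.
apply/hasP; exists q; first by rewrite -q_size subseq_subs ?filter_subseq.
rewrite /cgood pairbE; apply: pairwise_in => // i j.
rewrite !mem_q => /mapP[u uS ->] /mapP[v vS ->] cuv.
have uv : u != v by apply: contraNneq cuv => ->.
have /csepP[z [zt lz zq]] := S_sep u v uS vS uv.
by apply/csepP; exists z; rewrite mem_q.
Qed.

Lemma transversal_creduced : creduced H t.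
Proof.
have [c_uniq c_tw _] := c_tr; rewrite /creduced pairbE size_map.
apply: pairwise_in; first exact: iota_uniq.
move=> i j; rewrite !mem_iota !add0n /= => ic jc ij.
have := c_tw _ _ (mem_nth x0 ic) (mem_nth x0 jc); rewrite nth_uniq // => /(_ ij).
move=> /(not_twin e_sym e_irr)[z [zi zj ez]].
have := @sep_csep [:: r i; r j] (r i) (r j); rewrite /= !cell_nth //.
by apply; rewrite ?inE ?eqxx ?orbT //; apply: (sepI _ ez); rewrite !inE negb_or zi.
Qed.

Lemma diam2_cdiam2 :
  (forall u v, u != v -> ~~ e u v -> exists z, e z u && e z v) -> cdiam2 H t.
Proof.
have eN u v : e u v -> u != v by apply: contraTneq => ->; rewrite e_irr.
move=> D; have {}D u v : u != v -> ~~ link H t (cell u) (cell v) ->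
    exists z, [/\ z < size c, link H t z (cell u) & link H t z (cell v)].
  move=> uv; rewrite linkE // => /(D _ _ uv)[z /andP[zu zv]].
  by exists (cell z); rewrite cell_lt !linkE ?eN.
rewrite /cdiam2 size_map allbE; apply/allP => i; rewrite mem_iota /= => ic.
rewrite allbE; apply/allP => j; rewrite mem_iota /= => jc; have [ij|ij] := eqVneq i j.
  case: ifP => //; rewrite (nth_map x0) // => /class_type_mate[y yi ty].
  have cy : cell y = i by apply: cell_uniq; rewrite // twin_sym.
  have := D _ _ yi; rewrite cy cell_nth //; case: link => //= /(_ isT)[z [zc zi _]].
  by rewrite anybE; apply/hasP; exists z; rewrite // mem_iota.
have nij : r i != r j.
  by apply: contraNneq ij => /(congr1 cell); rewrite !cell_nth // => ->.
have := D _ _ nij; rewrite !cell_nth // {1}/link (negbTE ij); case: ifP => //= _.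
case/(_ isT) => z [zc zi zj]; rewrite anybE; apply/hasP.
by exists z; rewrite ?mem_iota // zi.
Qed.

End Bridge.

(** * Codes with respect to two vertices *)

Definition distinct3 (A : eqType) (x y z : A) := [&& x != y, x != z & y != z].

Section Config.
Variables (T : finType) (e : rel T).
Hypotheses (e_sym : symmetric e) (e_irr : irreflexive e).
Hypothesis no4 : ~ pack e 4.
Notation twin := (twin_eq e).
Implicit Types (w v x y z p q a b c : T).

Definition code w1 w2 v := (e w1 v, e w2 v).

Definition out w1 w2 : pred T := fun v => (v != w1) && (v != w2).

Definition config w1 w2 a b c :=
  [/\ out w1 w2 a, out w1 w2 b, out w1 w2 c &
      distinct3 (code w1 w2 a) (code w1 w2 b) (code w1 w2 c)].

Lemma config_swap w1 w2 a b c : config w1 w2 a b c -> config w1 w2 b a c.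
Proof.
case=> oa ob oc /and3P[ab ac bc]; split=> //.
by rewrite /distinct3 eq_sym ab bc.
Qed.

Lemma config_rot w1 w2 a b c : config w1 w2 a b c -> config w1 w2 b c a.
Proof.
case=> oa ob oc /and3P[ab ac bc]; split=> //.
by rewrite /distinct3 bc ![_ == code w1 w2 a]eq_sym ab.
Qed.

Lemma code_sep w1 w2 S x y : w1 \notin S -> w2 \notin S ->
  code w1 w2 x != code w1 w2 y -> sep e S x y.
Proof.
by move=> w1S w2S; rewrite xpair_eqE negb_and => /orP[|]; apply: sepI.
Qed.

Lemma out_notin w1 w2 S : all (out w1 w2) S -> (w1 \notin S) /\ (w2 \notin S).
Proof.
by move/allP=> oS; split; apply/negP => /oS; rewrite /out eqxx ?andbF.
Qed.

Lemma config_code w1 w2 a b c v : config w1 w2 a b c -> out w1 w2 v ->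
  code w1 w2 v \in [:: code w1 w2 a; code w1 w2 b; code w1 w2 c].
Proof.
move=> [oa ob oc /and3P[ab ac bc]] ov; apply/negPn/negP.
rewrite !inE !negb_or => /and3P[va vb vc]; apply: no4; exists [:: v; a; b; c] => //.
have [] := @out_notin w1 w2 [:: v; a; b; c]; first by rewrite /= oa ob oc ov.
by move=> w1S w2S; rewrite /good /= !(code_sep w1S w2S).
Qed.

(** Otherwise [z] splits [x] from [y], while [w1], [w2] split all other pairs of [x], [y], [p], [q].
    Hence only [p] and [q] can still tell [x] from [y]. *)
Lemma config_sep w1 w2 x p q y z : config w1 w2 x p q -> out w1 w2 y ->
  code w1 w2 y = code w1 w2 x -> z != x -> z != y -> z != p -> z != q ->
  e z x = e z y.
Proof.
move=> [ox op oq /and3P[xp xq pq]] oy yx zx zy zp zq.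
apply/eqP/negPn/negP => ezxy; apply: no4; exists [:: x; y; p; q] => //.
have [] := @out_notin w1 w2 [:: x; y; p; q]; first by rewrite /= ox op oq oy.
move=> w1S w2S; rewrite /good /= (sepI _ ezxy).
  by rewrite !(code_sep w1S w2S) ?yx.
by rewrite !inE !negb_or zx zy zp zq.
Qed.

Lemma config_twin w1 w2 x p q y : config w1 w2 x p q -> out w1 w2 y ->
  code w1 w2 y = code w1 w2 x -> e p x = e p y -> e q x = e q y -> twin x y.
Proof.
move=> cf oy yx epxy eqxy; apply/(twinP e_sym e_irr) => z zx zy.
have [->//|zp] := eqVneq z p; have [->//|zq] := eqVneq z q.
exact: config_sep cf oy yx zx zy zp zq.
Qed.

(** A second vertex [p'] with the code of [p] could replace [p] in the configuration; then [p] is an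
    outside vertex splitting [x] from [y], against [config_sep]. *)
Lemma config_alone w1 w2 x p q y p' : config w1 w2 x p q -> out w1 w2 y ->
  code w1 w2 y = code w1 w2 x -> e p x != e p y ->
  out w1 w2 p' -> code w1 w2 p' = code w1 w2 p -> p' = p.
Proof.
move=> [ox op oq d] oy yx epxy op' pp'; have /and3P[xp xq pq] := d.
have cf' : config w1 w2 x p' q by split=> //; rewrite /distinct3 pp' xp xq.
apply/eqP; rewrite eq_sym; apply: contraNT epxy => p'p; apply/eqP.
have codeN u v : code w1 w2 u != code w1 w2 v -> u != v by apply: contraNneq => ->.
by apply: (config_sep cf' oy yx _ _ p'p (codeN _ _ pq)); rewrite eq_sym codeN ?yx.
Qed.

(* The vertices coded like [a] may fall into two cells, split by [b]
   ([six_cells]), or into three, split by [b] and [c] ([seven_cells]). *)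
Definition six_cells w1 w2 b a1 a2 c :=
  [/\ config w1 w2 a1 b c, out w1 w2 a2, code w1 w2 a2 = code w1 w2 a1,
      e b a1 != e b a2 & covers e [:: w1; w2; b; a1; a2; c]].

Definition seven_cells w1 w2 b c a1 a2 a3 :=
  [/\ config w1 w2 a1 b c,
      [/\ out w1 w2 a2, code w1 w2 a2 = code w1 w2 a1,
          out w1 w2 a3 & code w1 w2 a3 = code w1 w2 a1],
      distinct3 (code b c a1) (code b c a2) (code b c a3),
      (forall v, out w1 w2 v -> code w1 w2 v = code w1 w2 b -> v = b) &
      (forall v, out w1 w2 v -> code w1 w2 v = code w1 w2 c -> v = c)].

Lemma config_split w1 w2 a b c v : config w1 w2 a b c -> out w1 w2 v ->
  code w1 w2 v = code w1 w2 a -> e b a != e b v ->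
  (exists a1 a2, six_cells w1 w2 b a1 a2 c) \/
  exists a1 a2 a3, seven_cells w1 w2 b c a1 a2 a3.
Proof.
move=> cf ov va ebav; have [oa ob oc d] := cf; have /and3P[ab ac bc] := d.
have codeN u1 u2 : code w1 w2 u1 != code w1 w2 u2 -> u1 != u2.
  by apply: contraNneq => ->.
have aloneb := config_alone cf ov va ebav.
have twinc c' : out w1 w2 c' -> code w1 w2 c' = code w1 w2 c -> twin c c'.
  move=> oc' cc'; have cfc : config w1 w2 c a b by do 2!apply: config_rot.
  have cfc' : config w1 w2 c v b by case: cfc => *; split=> //; rewrite va.
  apply: (config_twin cfc) => //.
    (* With [v] in place of [a] in the configuration, [a] is an outside vertex and cannot split [c]
       from [c']. *)
    apply/eqP/negPn/negP => eac; case/negP: (eac); apply/eqP.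
    have av : a != v by apply: contraNneq ebav => ->.
    by apply: (config_sep cfc' oc' cc' _ _ av); rewrite codeN ?cc'.
  (* Here [b] splits both the pair [a], [v] and the pair [c], [c']; the codes split the mixed
     pairs. *)
  apply/eqP/negPn/negP => ebc; apply: no4; exists [:: a; v; c; c'] => //.
  have [] := @out_notin w1 w2 [:: a; v; c; c']; first by rewrite /= oa ov oc oc'.
  have bS : b \notin [:: a; v; c; c'].
    by rewrite !inE !negb_or !codeN ?va ?cc' // eq_sym.
  move=> w1S w2S; rewrite /good /= (sepI bS ebav) (sepI bS ebc).
  by rewrite !(code_sep w1S w2S) ?va ?cc'.
(* Either adjacency to [b] decides the twin class among the vertices coded like [a], giving two
   cells, or two non-twins among them agree on [b] and are split by [c], giving three. *)
have [|nA] := boolP [forall x, forall y, [&& out w1 w2 x, out w1 w2 y,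
   code w1 w2 x == code w1 w2 a, code w1 w2 y == code w1 w2 a & e b x == e b y]
   ==> twin x y].
  move/forallP=> twA; left; exists a, v; split=> //; apply/forallP => x /=.
  have {}twA y : out w1 w2 x -> code w1 w2 x = code w1 w2 a -> out w1 w2 y ->
      code w1 w2 y = code w1 w2 a -> e b x = e b y -> twin x y.
    move=> ox xa oy ya exy; have /forallP/(_ y) := twA x.
    by rewrite ox oy xa ya exy !eqxx.
  have [->|xw1] := eqVneq x w1; first by rewrite twin_refl.
  have [->|xw2] := eqVneq x w2; first by rewrite twin_refl !orbT.
  have ox : out w1 w2 x by rewrite /out xw1.
  have := config_code cf ox; rewrite !inE => /or3P[]/eqP xx.
  - have [bxa|bxa] := eqVneq (e b x) (e b a); first by rewrite (twA a) ?orbT.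
    rewrite (twA v) ?orbT //.
    by move: ebav bxa; case: (e b a); case: (e b v); case: (e b x).
  - by rewrite (aloneb _ ox xx) twin_refl !orbT.
  - by rewrite (twin_sym e_sym e_irr x c) twinc ?orbT.
right; have {nA}[x [y [ox oy xa ya [bxy txy]]]] : exists x y,
    [/\ out w1 w2 x, out w1 w2 y, code w1 w2 x = code w1 w2 a,
        code w1 w2 y = code w1 w2 a & e b x = e b y /\ ~~ twin x y].
  move: nA; rewrite negb_forall => /existsP[x]; rewrite negb_forall.
  move=> /existsP[y]; rewrite negb_imply => /andP[/and5P[ox oy /eqP xa /eqP ya /eqP]].
  by exists x, y.
have cfx : config w1 w2 x b c by split=> //; rewrite xa.
have yx : code w1 w2 y = code w1 w2 x by rewrite ya.
have ecxy : e c x != e c y.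
  by apply: contra txy => /eqP; apply: (config_twin cfx oy yx bxy).
have alonec := config_alone (config_rot (config_swap cfx)) oy yx ecxy.
have [x' [ox' x'a bx']] : exists x', [/\ out w1 w2 x',
    code w1 w2 x' = code w1 w2 a & e b x' != e b x].
  have [eab|eab] := eqVneq (e b a) (e b x); last by exists a.
  by exists v; rewrite eq_sym -eab.
exists x, y, x'; split=> //; first by rewrite ya xa x'a.
by rewrite /distinct3 !xpair_eqE -!bxy eqxx /= ecxy !negb_and ![e b x == _]eq_sym bx'.
Qed.

(** A vertex [v] missed by the five has the code of one of [a], [b], [c] without being its twin. By
    [config_twin] one of the other two splits them, and [config_split] applies after renaming. *)
Lemma config_cases w1 w2 a b c : config w1 w2 a b c ->
  [\/ covers e [:: w1; w2; a; b; c],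
      exists b a1 a2 c, six_cells w1 w2 b a1 a2 c |
      exists b c a1 a2 a3, seven_cells w1 w2 b c a1 a2 a3].
Proof.
move=> cf; have [cov|] := boolP (covers e [:: w1; w2; a; b; c]).
  by constructor 1.
rewrite negb_forall => /existsP[v /hasPn vN].
have ov : out w1 w2 v.
  have vw w : w \in [:: w1; w2; a; b; c] -> v != w.
    by move/vN; apply: contraNneq => <-; apply: twin_refl.
  by apply/andP; split; apply: vw; rewrite !inE eqxx ?orbT.
have main x p q : config w1 w2 x p q -> code w1 w2 v = code w1 w2 x -> ~~ twin v x ->
  (exists b a1 a2 c, six_cells w1 w2 b a1 a2 c) \/
  (exists b c a1 a2 a3, seven_cells w1 w2 b c a1 a2 a3).
  move=> cfx vx tvx; have [epx|epx] := eqVneq (e p x) (e p v); last first.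
    have [[a1 [a2 s]]|[a1 [a2 [a3 s]]]] := config_split cfx ov vx epx.
      by left; exists p, a1, a2, q.
    by right; exists p, q, a1, a2, a3.
  have [eqx|eqx] := eqVneq (e q x) (e q v).
    by case/negP: tvx; rewrite twin_sym // (config_twin cfx ov vx).
  have cfx' := config_rot (config_swap cfx).
  have [[a1 [a2 s]]|[a1 [a2 [a3 s]]]] := config_split cfx' ov vx eqx.
    by left; exists q, a1, a2, p.
  by right; exists q, p, a1, a2, a3.
suff [?|?] : (exists b a1 a2 c, six_cells w1 w2 b a1 a2 c) \/
  (exists b c a1 a2 a3, seven_cells w1 w2 b c a1 a2 a3) 
  by [constructor 2|constructor 3].
have := config_code cf ov; rewrite !inE => /or3P[]/eqP.
- by move/(main _ _ _ cf); apply; rewrite vN // !inE eqxx ?orbT.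
- by move/(main _ _ _ (config_rot cf)); apply; rewrite vN // !inE eqxx ?orbT.
- move/(main _ _ _ (config_rot (config_rot cf))); apply.
  by rewrite vN // !inE eqxx ?orbT.
Qed.

End Config.

(** * At most five twin classes *)

(* A graph on [0 .. k-1] is the list of the rows of the strict upper triangle
   of its adjacency matrix. *)
Fixpoint adj (g : seq bitseq) (i j : nat) : bool :=
  match g, i, j with
  | _ :: g', i'.+1, j'.+1 => adj g' i' j'
  | r :: _, 0, j'.+1 => nth false r j'
  | r :: _, i'.+1, 0 => nth false r i'
  | _, _, _ => false
  end.

Fixpoint graphs (k : nat) : seq (seq bitseq) :=
  if k is k'.+1 then
    [seq r :: g | r <- words [:: true; false] k', g <- graphs k']
  else [:: [::]].

Fixpoint rows (T : Type) (e : rel T) (c : seq T) : seq bitseq :=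
  if c is x :: s then map (e x) s :: rows e s else [::].

Lemma rows_graphs (T : Type) (e : rel T) c : rows e c \in graphs (size c).
Proof.
elim: c => [|x s IHs] //=; apply/allpairsP; exists (map (e x) s, rows e s).
by rewrite IHs -(size_map (e x)) bitseq_words.
Qed.

Lemma adj_rows (T : Type) (e : rel T) (x0 : T) c i j : symmetric e ->
  i < size c -> j < size c -> i != j ->
  adj (rows e c) i j = e (nth x0 c i) (nth x0 c j).
Proof.
move=> e_sym; elim: c i j => [|x s IHs] [|i] [|j] //=.
- by move=> _ js _; rewrite (nth_map x0).
- by move=> js _ _; rewrite (nth_map x0) // e_sym.
- exact: IHs.
Qed.

(** Vertex order [w1], [w2], [b], [a1], [a2], [c]. Both [a1] and [a2] have code [(p1, p2)], and [b]
    is adjacent to [a1] but not to [a2]. *)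
Definition six_graph p1 p2 b1 b2 c1 c2 ww bc ca1 ca2 aa : seq bitseq :=
  [:: [:: ww; b1; p1; p1; c1]; [:: b2; p2; p2; c2]; [:: true; false; bc];
      [:: aa; ca1]; [:: ca2]; [::]].

(** Vertex order [w1], [w2], [b], [c], [u3], [b'], [c'] as in [seven_twice]. The last three share
    the code [(a1, a2)], and [u3] has the adjacencies of [w1] to [b] and [c]. *)
Definition seven_graph a1 a2 b1 b2 c1 c2 e1 e2 f1 f2 ww bc ab ac bc' : seq bitseq :=
  [:: [:: ww; b1; c1; a1; a1; a1]; [:: b2; c2; a2; a2; a2]; [:: bc; b1; e1; f1];
      [:: c1; e2; f2]; [:: ab; ac]; [:: bc']; [::]].

(** With [pred0] as goal, the search succeeds only if no assignment of types survives: six distinct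
    classes in this pattern are impossible. *)
Definition six_check := allb (fun v : seq bool =>
  if v is [:: p1; p2; b1; b2; c1; c2; ww; bc; ca1; ca2; aa] then
    if ~~ distinct3 (p1, p2) (b1, b2) (c1, c2) then true else
    let H := adj (six_graph p1 p2 b1 b2 c1 c2 ww bc ca1 ca2 aa) in
    if ~~ cdiam2 H (nseq 6 None) then true else search H pred0 6 [::]
  else true) (words [:: true; false] 11).

(** The last five adjacencies are enumerated only for consistent codes. All types are [None] because
    seven vertices are tested, not seven classes. *)
Definition seven_check := allb (fun v : seq bool =>
  if v is [:: a1; a2; b1; b2; c1; c2; e1; e2; f1; f2] then
    if ~~ distinct3 (a1, a2) (b1, b2) (c1, c2) then true else
    if ~~ distinct3 (b1, c1) (e1, e2) (f1, f2) then true else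
    if ~~ ((b1 == b2) && (c1 == c2)) then true else
    allb (fun u : seq bool => if u is [:: ww; bc; ab; ac; bc'] then
      if ~~ distinct3 (a1, a1) (a2, a2) (ab, ac) then true else
      cpack (adj (seven_graph a1 a2 b1 b2 c1 c2 e1 e2 f1 f2 ww bc ab ac bc'))
            (nseq 7 None) 4
    else true) (words [:: true; false] 5)
  else true) (words [:: true; false] 10).

Lemma six_checkT : six_check. Proof. by vm_compute. Qed.
Lemma seven_checkT : seven_check. Proof. by vm_compute. Qed.

Lemma six_checkP p1 p2 b1 b2 c1 c2 ww bc ca1 ca2 aa
    (H := adj (six_graph p1 p2 b1 b2 c1 c2 ww bc ca1 ca2 aa)) :
  distinct3 (p1, p2) (b1, b2) (c1, c2) -> cdiam2 H (nseq 6 None) ->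
  search H pred0 6 [::].
Proof.
rewrite {}/H => d diam; have := six_checkT; rewrite /six_check allbE => /allP.
move/(_ _ (bitseq_words [:: p1; p2; b1; b2; c1; c2; ww; bc; ca1; ca2; aa])).
by cbv beta iota zeta; rewrite d diam.
Qed.

Lemma seven_checkP a1 a2 b1 b2 c1 c2 e1 e2 f1 f2 ww bc ab ac bc' :
  distinct3 (a1, a2) (b1, b2) (c1, c2) -> distinct3 (b1, c1) (e1, e2) (f1, f2) ->
  b1 = b2 -> c1 = c2 -> distinct3 (a1, a1) (a2, a2) (ab, ac) ->
  cpack (adj (seven_graph a1 a2 b1 b2 c1 c2 e1 e2 f1 f2 ww bc ab ac bc'))
        (nseq 7 None) 4.
Proof.
move=> d1 d2 bb cc d3; have := seven_checkT; rewrite /seven_check allbE => /allP.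
move/(_ _ (bitseq_words [:: a1; a2; b1; b2; c1; c2; e1; e2; f1; f2])).
cbv beta iota zeta; rewrite d1 d2 -bb -cc !eqxx; cbv beta iota zeta delta [negb andb].
rewrite allbE => /allP/(_ _ (bitseq_words [:: ww; bc; ab; ac; bc'])).
by cbv beta iota zeta; rewrite d3.
Qed.

Lemma adj_sym g : symmetric (adj g).
Proof. by elim: g => [|r g IHg] [|i] [|j] //=; apply: IHg. Qed.

(** A common neighbour of two non-adjacent classes is a third class, so types do not affect it. This
    allows graphs to be rejected before types are enumerated. *)
Lemma cdiam2_nseq H t : symmetric H -> cdiam2 H t -> cdiam2 H (nseq (size t) None).
Proof.
rewrite /cdiam2 size_nseq !allbE => H_sym /allP D; apply/allP => i ik.
have := D i ik; rewrite !allbE => /allP {}D; apply/allP => j jk; have := D j jk.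
have [_|ij] := eqVneq i j; first by rewrite nth_nseq if_same.
case: ifP => // /negbT Hij; rewrite !anybE => /hasP[z zk lz].
apply/hasP; exists z => //.
have {}Hij := negbTE Hij.
have [zi|zi] := eqVneq z i.
  by move: lz; rewrite /link zi eqxx (negbTE ij) Hij; case: ifP.
have [zj|zj] := eqVneq z j.
  by move: lz; rewrite /link zj eqxx eq_sym (negbTE ij) H_sym Hij.
by move: lz; rewrite /link (negbTE zi) (negbTE zj).
Qed.

(** * Excluding six and seven cells in the graph itself *)

Section Bound.
Variables (T : finType) (e : rel T).
Hypotheses (e_sym : symmetric e) (e_irr : irreflexive e).
Hypothesis no4 : ~ pack e 4.
Hypothesis e_diam : forall u v, u != v -> ~~ e u v -> exists z, e z u && e z v.
Notation twin := (twin_eq e).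

(** Separators inside an induced subgraph remain separators in the graph; the list [c] may miss
    classes or contain twins, unlike in [packE]. *)
Lemma induced_pack (x0 : T) (H : rel nat) c s : uniq c ->
  (forall i j, i < size c -> j < size c -> i != j ->
     H i j = e (nth x0 c i) (nth x0 c j)) ->
  cpack H (nseq (size c) None) s -> pack e s.
Proof.
move=> c_uniq HE; rewrite /cpack anybE size_nseq.
move=> /hasP[q /(subsP (iota_uniq _ _))[q_uniq q_size q_lt]].
have lt_q k : k \in q -> k < size c by move/q_lt; rewrite mem_iota.
rewrite /cgood pairbE => q_good; exists (map (nth x0 c) q); first by rewrite size_map.
apply: pairwise_in.
  rewrite map_inj_in_uniq // => i j /lt_q ic /lt_q jc /eqP.
  by rewrite nth_uniq // => /eqP.
move=> _ _ /mapP[i iq ->] /mapP[j jq ->] ij.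
have {}ij : i != j by apply: contraNneq ij => ->.
have /csepP[z []] := in_pairwise (@csep_sym _ _ _) q_good iq jq ij.
rewrite size_nseq nth_nseq if_same orbF => zc lz zq.
have zN k : k \in q -> z != k by apply: contraTneq => <-.
apply: (@sepI _ _ _ _ _ (nth x0 c z)).
  apply: contra zq => /mapP[k kq] /eqP.
  by rewrite nth_uniq // ?lt_q // => /eqP->.
by move: lz; rewrite /link !(negbTE (zN _ _)) // !HE // ?lt_q ?zN.
Qed.

(** Two separators suffice for three vertices: the first splits one off, the second splits the
    remaining two. *)
Lemma pack_config : pack e 3 -> exists w1 w2 a b c, config e w1 w2 a b c.
Proof.
move=> [[|a [|b [|c []]]] //= _]; rewrite /good /= !andbT.
move=> /andP[/andP[/existsP[w /andP[wS wab]] ac] bc].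
have [wac|wac] := eqVneq (e w a) (e w c).
  have /existsP[w' /andP[w'S wac']] := ac; exists w, w', a, b, c.
  move: wS w'S; rewrite !inE !negb_or => /and3P[wa wb wc] /and3P[wa' wb' wc'].
  split; rewrite /out 1?[_ == w]eq_sym 1?[_ == w']eq_sym ?wa ?wb ?wc //.
  rewrite /distinct3 /code !xpair_eqE !negb_and -wac ![e w b == _]eq_sym.
  by rewrite wab wac' orbT.
have {}wbc : e w b = e w c.
  by move: wab wac; case: (e w a); case: (e w b); case: (e w c).
have /existsP[w' /andP[w'S wbc']] := bc; exists w, w', a, b, c.
move: wS w'S; rewrite !inE !negb_or => /and3P[wa wb wc] /and3P[wa' wb' wc'].
split; rewrite /out 1?[_ == w]eq_sym 1?[_ == w']eq_sym ?wa ?wb ?wc //.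
by rewrite /distinct3 /code !xpair_eqE !negb_and wab wac wbc' orbT.
Qed.

Lemma config_neq w1 w2 a b c : config e w1 w2 a b c -> w1 != w2.
Proof.
case=> _ _ _; apply: contraTneq => ->; rewrite /distinct3 /code !xpair_eqE !andbb.
by case: (e w2 a); case: (e w2 b); case: (e w2 c).
Qed.

Lemma six_classes w1 w2 b a1 a2 c : six_cells e w1 w2 b a1 a2 c ->
  exists2 R, twin_transversal e R & size R <= 5.
Proof.
wlog ba1 : a1 a2 / e b a1 = true => [main s|].
  case ba1: (e b a1); first exact: main ba1 s.
  case: s => [[oa1 ob oc d] oa2 a21 ba cov]; apply: (main a2 a1).
    by move: ba; rewrite ba1; case: (e b a2).
  split=> //; rewrite 1?eq_sym //; first by split=> //; rewrite a21.
  apply/(coversP e) => v; have /(coversP e)/(_ v)[x xR vx] := cov.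
  exists x => //; move: xR; rewrite !inE.
  by do 3!case: (x == _) => //=; rewrite orbCA.
case=> [cf oa2 a21 ba cov]; have [oa1 ob oc d] := cf.
have [R_tr|[R R_tr ltR]] := covers_twin_transversal e_sym e_irr cov; last by exists R.
have ba2 : e b a2 = false by move: ba; rewrite ba1; case: (e b a2).
set R := [:: _; _; _; _; _; _] in R_tr.
have [w1a w2a] : e w1 a2 = e w1 a1 /\ e w2 a2 = e w2 a1 by case: a21.
have HE i j := @adj_rows _ e w1 R i j e_sym.
have no4' : ~~ cpack (adj (rows e R)) (map (class_type e) R) 4.
  by apply/negP => /(packE e_sym e_irr R_tr HE).
have red := transversal_creduced e_sym e_irr R_tr HE.
have diam := diam2_cdiam2 e_sym e_irr R_tr HE e_diam.
have := @six_checkP (e w1 a1) (e w2 a1) (e w1 b) (e w2 b) (e w1 c) (e w2 c)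
  (e w1 w2) (e b c) (e a1 c) (e a2 c) (e a1 a2).
have -> : six_graph (e w1 a1) (e w2 a1) (e w1 b) (e w2 b) (e w1 c) (e w2 c)
  (e w1 w2) (e b c) (e a1 c) (e a2 c) (e a1 a2) = rows e R.
  by rewrite /= w1a w2a ba1 ba2.
move=> /(_ d (cdiam2_nseq (adj_sym _) diam)).
by move/(searchP (t := map (class_type e) R) no4' red diam).
Qed.

Lemma seven_swap w1 w2 b c a1 a2 a3 :
  seven_cells e w1 w2 b c a1 a2 a3 -> seven_cells e w1 w2 b c a2 a1 a3.
Proof.
case=> [[oa1 ob oc d] [oa2 a21 oa3 a31] d' alb alc].
split=> //; first by split=> //; rewrite a21.
  by rewrite a21.
by case/and3P: d' => *; rewrite /distinct3 eq_sym; apply/and3P.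
Qed.

Lemma seven_rot w1 w2 b c a1 a2 a3 :
  seven_cells e w1 w2 b c a1 a2 a3 -> seven_cells e w1 w2 b c a2 a3 a1.
Proof.
case=> [[oa1 ob oc d] [oa2 a21 oa3 a31] d' alb alc].
split=> //; first by split=> //; rewrite a21.
  by rewrite a21.
case/and3P: d' => *; rewrite /distinct3 ![_ == code e b c a1]eq_sym.
by apply/and3P.
Qed.

Lemma seven_config w1 w2 b c a1 a2 a3 :
  seven_cells e w1 w2 b c a1 a2 a3 -> config e b c a1 a2 a3.
Proof.
case=> [[_ _ _ /and3P[ab ac _]] [_ a21 _ a31] d' _ _].
have codeN u v : code e w1 w2 u != code e w1 w2 v -> u != v by apply: contraNneq => ->.
by split=> //; rewrite /out !codeN ?a21 ?a31.
Qed.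

Lemma seven_code w1 w2 b c a1 a2 a3 v : seven_cells e w1 w2 b c a1 a2 a3 ->
  out w1 w2 v -> out b c v -> code e w1 w2 v = code e w1 w2 a1.
Proof.
case=> cf _ _ alb alc ov /andP[vb vc].
have := config_code no4 cf ov; rewrite !inE => /or3P[]/eqP //.
  by move/(alb _ ov) => E; rewrite E eqxx in vb.
by move/(alc _ ov) => E; rewrite E eqxx in vc.
Qed.

(** Some [a1], [a2] or [a3] has the [(b, c)]-code of [v], hence equals [v]; and these three avoid
    [w1] and [w2]. *)
Lemma seven_alone w1 w2 b c a1 a2 a3 v : seven_cells e w1 w2 b c a1 a2 a3 ->
  out b c v -> (forall u, out b c u -> code e b c u = code e b c v -> u = v) ->
  out w1 w2 v.
Proof.
move=> s ov alv; have [oa1 oa2 oa3 _] := seven_config s.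
have [[oa1' _ _ _] [oa2' _ oa3' _] _ _ _] := s.
have := config_code no4 (seven_config s) ov; rewrite !inE => /or3P[]/eqP/esym.
- by move/(alv _ oa1) => <-.
- by move/(alv _ oa2) => <-.
- by move/(alv _ oa3) => <-.
Qed.

(* In a [seven_cells] pattern [b], [c] and the [a]'s form a configuration in turn; were
   it again of this kind, the seven_cells vertices involved would contain a good set of
   size 4. *)
Lemma seven_twice w1 w2 b c a1 a2 a3 b' c' x1 x2 x3 :
  seven_cells e w1 w2 b c a1 a2 a3 -> ~ seven_cells e b c b' c' x1 x2 x3.
Proof.
move=> s s'; have [cf _ _ _ _] := s; have [oa ob oc dw] := cf.
have inA v : out w1 w2 v -> out b c v -> code e w1 w2 v = code e w1 w2 a1.
  exact: seven_code s.
have w12 := config_neq cf; have bc := config_neq (seven_config s).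
have bc' := config_neq (seven_config s').
(* The rigid case: two of the [x]'s are [w1] and [w2]. By [seven_alone] the vertices [b'], [c']
   avoid [w1], [w2], so they are coded like [a1], and [seven_checkP] applies. *)
have core u1 u2 u3 : seven_cells e b c b' c' u1 u2 u3 -> u1 = w1 -> u2 = w2 ->
    out w1 w2 u3 -> False.
  move=> {}s' u1w u2w ou; rewrite {}u1w {}u2w in s'.
  have [[ow1 ob' oc' d1] [ow2 w21 ou3 u31] d2 alb alc] := s'.
  have wb' := seven_alone s ob' alb; have wc' := seven_alone s oc' alc.
  have [[wu1 wu2] [wb1 wb2] [wc1 wc2]] : [/\ e w1 u3 = e w1 a1 /\ e w2 u3 = e w2 a1,
      e w1 b' = e w1 a1 /\ e w2 b' = e w2 a1 & e w1 c' = e w1 a1 /\ e w2 c' = e w2 a1].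
    by split; split; [case: (inA u3 ou ou3)|case: (inA u3 ou ou3)|
      case: (inA b' wb' ob')|case: (inA b' wb' ob')|
      case: (inA c' wc' oc')|case: (inA c' wc' oc')].
  have [bw cw] : e b w2 = e b w1 /\ e c w2 = e c w1 by case: w21.
  have [bu cu] : e b u3 = e b w1 /\ e c u3 = e c w1 by case: u31.
  pose S := [:: w1; w2; b; c; u3; b'; c'].
  have S_uniq : uniq S.
    have [uw1 uw2] := andP ou; have [b1 b2] := andP ob; have [c1 c2] := andP oc.
    have [b'1 b'2] := andP wb'; have [c'1 c'2] := andP wc'.
    have [ub uc] := andP ou3; have [b'b b'c] := andP ob'; have [c'b c'c] := andP oc'.
    have [_ _ /andP[ub' uc'] d3] := seven_config s'.
    rewrite /= !inE !negb_or w12 bc bc' !andbT /=.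
    by rewrite ![w1 == _]eq_sym ![w2 == _]eq_sym [b == u3]eq_sym [b == b']eq_sym
      [b == c']eq_sym [c == u3]eq_sym [c == b']eq_sym [c == c']eq_sym
      uw1 uw2 b1 b2 c1 c2 b'1 b'2 c'1 c'2
      ub uc ub' uc' b'b b'c c'b c'c.
  apply: no4; apply: (@induced_pack w1 (adj (rows e S)) S) => //.
    by move=> i j; apply: adj_rows.
  have -> : rows e S = seven_graph (e w1 a1) (e w2 a1) (e w1 b) (e w2 b) (e w1 c)
      (e w2 c) (e b b') (e c b') (e b c') (e c c') (e w1 w2) (e b c) (e u3 b')
      (e u3 c') (e b' c').
    by rewrite /= wu1 wu2 wb1 wb2 wc1 wc2 bu cu ![e _ w1]e_sym.
  apply: seven_checkP => //.
  - by rewrite [e w1 b]e_sym [e w1 c]e_sym.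
  - by rewrite e_sym -bw e_sym.
  - by rewrite e_sym -cw e_sym.
  - move: d2; rewrite /code ![e b' _]e_sym ![e c' _]e_sym.
    by rewrite wb1 wb2 wc1 wc2.
have dich v : out b c v -> [\/ v = w1, v = w2 | out w1 w2 v].
  have [->|v1] := eqVneq v w1; first by constructor 1.
  have [->|v2] := eqVneq v w2; first by constructor 2.
  by constructor 3; rewrite /out v1.
(* Two of the [x]'s outside [w1, w2] would lie in the same twin class. *)
have two u1 u2 u3 : seven_cells e b c b' c' u1 u2 u3 ->
    out w1 w2 u1 -> out w1 w2 u2 -> False.
  move=> {}s' ou1 ou2; have [cf' [ob2 u21 _ _] /and3P[/negP d12 _ _] _ _] := s'.
  have [ob1 ob' oc' /and3P[d1b d1c _]] := cf'; apply: d12.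
  have cfu : config e w1 w2 u1 b c.
    by split; rewrite // (inA u1).
  have uu : code e w1 w2 u2 = code e w1 w2 u1 by rewrite !inA.
  have codeN u v : code e b c u != code e b c v -> v != u by apply: contraNneq => ->.
  have [b'b b'c] := andP ob'; have [c'b c'c] := andP oc'.
  (* Seen from [w1], [w2], only [b] and [c] could split [u1] from [u2], yet one of [b'], [c']
     does. *)
  have sepE z : z != u1 -> z != u2 -> z != b -> z != c -> e z u1 = e z u2.
    exact: (config_sep no4 cfu ou2 uu).
  have outN z : code e b c u1 != code e b c z -> z != u1 /\ z != u2.
    by move=> uz; split; apply: codeN; rewrite ?u21.
  have [[b1 b2] [c1 c2]] := (outN _ d1b, outN _ d1c).
  by rewrite /code !sepE.
have fin u1 u2 u3 : seven_cells e b c b' c' u1 u2 u3 -> u1 = w1 -> False.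
  move=> s1 u1w; have [[_ _ _ _] [ou2 _ ou3 _] /and3P[d12 d13 d23] _ _] := s1.
  have [u2w|u2w|ou2'] := dich u2 ou2.
  - by rewrite u1w u2w eqxx in d12.
  - have [u3w|u3w|ou3'] := dich u3 ou3.
    + by rewrite u1w u3w eqxx in d13.
    + by rewrite u2w u3w eqxx in d23.
    + exact: core s1 u1w u2w ou3'.
  - have [u3w|u3w|ou3'] := dich u3 ou3.
    + by rewrite u1w u3w eqxx in d13.
    + exact: core (seven_rot (seven_swap s1)) u1w u3w ou2'.
    + exact: two (seven_rot s1) ou2' ou3'.
(* The [x]'s are distinct, so if [w1] is not among them, at most one is [w2] and two lie outside; a
   rotation leads to [fin] or [two]. *)
have r' := seven_rot s'; have r'' := seven_rot r'.
have [[ox1 _ _ _] [ox2 _ ox3 _] /and3P[d12 d13 d23] _ _] := s'.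
have [x1w|x1w|ox1'] := dich x1 ox1; first exact: fin s' x1w.
  have [x2w|x2w|ox2'] := dich x2 ox2; first exact: fin r' x2w.
    by rewrite x1w x2w eqxx in d12.
  have [x3w|x3w|ox3'] := dich x3 ox3; first exact: fin r'' x3w.
    by rewrite x1w x3w eqxx in d13.
  exact: two r' ox2' ox3'.
have [x2w|x2w|ox2'] := dich x2 ox2; first exact: fin r' x2w.
  have [x3w|x3w|ox3'] := dich x3 ox3; first exact: fin r'' x3w.
    by rewrite x2w x3w eqxx in d23.
  exact: two r'' ox3' ox1'.
exact: two s' ox1' ox2'.
Qed.

Lemma few_twin_classes : pack e 3 -> exists2 R, twin_transversal e R & size R <= 5.
Proof.
move=> /pack_config[w1 [w2 [a [b [c cf]]]]].
have small x y z u v : covers e [:: x; y; z; u; v] ->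
    exists2 R, twin_transversal e R & size R <= 5.
  case/(covers_twin_transversal e_sym e_irr) => [R_tr|[R R_tr ltR]].
    by exists [:: x; y; z; u; v].
  by exists R => //; apply: ltnW.
have [|[b' [a1 [a2 [c' s]]]]|[b' [c' [a1 [a2 [a3 s]]]]]] :=
    config_cases e_sym e_irr no4 cf.
- exact: small.
- exact: six_classes s.
have [|[b2 [x1 [x2 [c2 s']]]]|[b2 [c2 [x1 [x2 [x3 s']]]]]] :=
    config_cases e_sym e_irr no4 (seven_config s).
- exact: small.
- exact: six_classes s'.
by case: (seven_twice s s').
Qed.

End Bound.

(** * Enumeration of the typed twin graphs *)

Section Templates.
Variable t : seq (option bool).
Definition is1 i := nth None t i == None.
Definition isK i := nth None t i == Some true.
Definition isN i := nth None t i == Some false.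
Definition is1K i := is1 i || isK i.
Definition is1N i := is1 i || isN i.
Definition isKN i := isK i || isN i.
End Templates.

(* Template [n] is the structure G_n. *)
Definition template_order n := nth 0 [:: 0; 3; 3; 4; 5; 5; 5; 5; 4; 4; 5] n.

Definition template_edges n : seq (nat * nat) :=
  match n with
  | 1 => [:: (0,1); (1,2); (0,2)]
  | 2 => [:: (0,1); (1,2)]
  | 3 => [:: (0,1); (1,2); (0,2); (0,3)]
  | 4 => [:: (0,1); (1,2); (2,3); (3,4); (4,0)]
  | 5 => [:: (0,1); (1,2); (2,3); (3,4); (4,0); (0,2)]
  | 6 => [:: (0,1); (1,2); (2,3); (3,4); (4,0); (0,2); (0,3)]
  | 7 => [:: (0,1); (0,2); (0,3); (1,2); (1,3); (0,4)]
  | 8 => [:: (0,1); (0,2); (0,3); (1,2); (1,3)]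
  | 9 => [:: (0,1); (1,2); (2,3); (3,0)]
  | 10 => [:: (0,1); (1,2); (2,3); (3,0); (0,4); (1,4); (2,4); (3,4)]
  | _ => [::]
  end.

Definition template_adj n : rel nat :=
  fun i j => ((i, j) \in template_edges n) || ((j, i) \in template_edges n).

Definition template_types n (t : seq (option bool)) : bool :=
  match n with
  | 1 => count (is1K t) (iota 0 3) <= 1
  | 2 => isN t 1 && isK t 0 || isK t 0 && isKN t 2
  | 3 => [&& isN t 1, is1K t 2, is1N t 3 &
             isK t 1 || isK t 2 ==> ~~ isN t 3 && ~~ isN t 0]
  | 4 => all (is1 t) (iota 0 5)
  | 5 => [&& is1 t 3, is1 t 4, is1K t 0, is1K t 1 & is1K t 2]
  | 6 => [&& all (is1K t) (iota 1 4),
             all (fun i => all (fun j => (i != j) && ~~ template_adj 6 i j ==>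
               ~~ (isK t i && isK t j)) (iota 0 5)) (iota 0 5) &
             all (fun i => all (fun j => template_adj 6 i j ==>
               ~~ (isK t i && isN t j)) (iota 0 5)) (iota 0 5)]
  | 7 => [&& is1 t 4, is1K t 0, is1K t 1, isK t 2 & is1 t 3]
  | 8 => [&& isK t 2, is1 t 3, isN t 0 & is1K t 1]
  | 9 => [&& isK t 0, isK t 1, is1 t 2 & is1 t 3]
  | 10 => [&& isK t 0, isK t 1, is1K t 4, is1 t 2 & is1 t 3]
  | _ => false
  end.

Definition templates k := [seq n <- iota 1 10 | template_order n == k].

Definition matches n (H : rel nat) (p : seq nat) :=
  allb (fun i => allb (fun j =>
    H (nth 0 p i) (nth 0 p j) == template_adj n i j)
  (iota 0 (template_order n))) (iota 0 (template_order n)).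

Definition degree (H : rel nat) k i := count (H i) (iota 0 k).

(* Up to reordering the classes, the first one has maximal degree and its
   neighbours come first. *)
Definition complete_check k :=
  let ps := permutations (iota 0 k) in
  allb (fun d => allb (fun g =>
    let H := adj ((nseq d true ++ nseq (k.-1 - d) false) :: g) in
    if ~~ allb (fun i => degree H k i <= degree H k 0) (iota 0 k) then true else
    if ~~ cdiam2 H (nseq k None) then true else
    let ms := [seq (n, [seq p <- ps | matches n H p]) | n <- templates k] in
    search H (fun t => if ~~ cpack H t 3 then true else
      anyb (fun m =>
        anyb (fun p => template_types m.1 [seq nth None t i | i <- p]) m.2) ms)
      k [::]) (graphs k.-1)) (iota 0 k).

Definition sound_check n := allb (fun t => if template_types n t then
    if cpack (template_adj n) t 4 then false else cpack (template_adj n) t 3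
  else true) (words ctypes (template_order n)).

Lemma complete_checkT : all complete_check (iota 1 5).
Proof. by vm_compute. Qed.

Lemma sound_checkT : all sound_check (iota 1 10).
Proof. by vm_compute. Qed.

Section Realization.
Variables (T : finType) (e : rel T) (x0 : T).
Hypotheses (e_sym : symmetric e) (e_irr : irreflexive e).
Notation twin := (twin_eq e).

Definition realizes n c :=
  [/\ twin_transversal e c, size c = template_order n,
      forall i j, i < template_order n -> j < template_order n ->
        template_adj n i j = e (nth x0 c i) (nth x0 c j) &
      template_types n (map (class_type e) c)].

Lemma realizes_pack n c : 0 < n <= 10 -> realizes n c -> pack e 3 /\ ~ pack e 4.
Proof.
move=> n_ok [c_tr c_size cE c_types].
have HE i j : i < size c -> j < size c -> i != j ->
    template_adj n i j = e (nth x0 c i) (nth x0 c j).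
  by rewrite c_size => ic jc _; apply: cE.
have /allP/(_ n) := sound_checkT; rewrite mem_iota => /(_ n_ok).
rewrite /sound_check allbE => /allP.
have t_in : map (class_type e) c \in words ctypes (template_order n).
  rewrite -c_size -(size_map (class_type e)).
  by apply: wordsP => x _; apply: mem_ctypes.
move/(_ _ t_in); rewrite c_types; case: ifP => // no4.
move/(packE e_sym e_irr c_tr HE) => p3; split=> //.
by move/(packE e_sym e_irr c_tr HE); rewrite no4.
Qed.

(** The first row becomes a block of ones followed by zeros, determined by its length [d], so that
    [k] first rows are enumerated instead of [2^(k-1)]. *)
Lemma transversal_head c : twin_transversal e c -> exists c' d,
  [/\ twin_transversal e c', size c' = size c, d < size c',
      rows e c' = (nseq d true ++ nseq ((size c').-1 - d) false) :: rows e (behead c') &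
      forall y, y \in c' -> count (e y) c' <= count (e (nth x0 c' 0)) c'].
Proof.
move=> c_tr; have [_ _ /coversP/(_ x0)[y0 y0c _]] := c_tr.
pose P := [pred x | x \in c].
case: (@arg_maxnP _ y0 P (fun x => count (e x) c)) => // x /= xc x_max.
pose r := rem x c; pose s := [seq y <- r | e x y] ++ [seq y <- r | ~~ e x y].
have perm_c : perm_eq c (x :: s).
  apply: perm_trans (perm_to_rem xc) _; rewrite perm_cons perm_sym.
  exact: permEl (perm_filterC _ _).
exists (x :: s), (size [seq y <- r | e x y]); split.
- exact: perm_twin_transversal c_tr.
- by rewrite (perm_size perm_c).
- by rewrite /= ltnS size_cat leq_addr.
- rewrite /= map_cat size_cat addKn -!(size_map (e x)); congr ((_ ++ _) :: _).
    apply/all_pred1P; rewrite all_map all_filter; apply/allP => y _ /=.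
    by rewrite eqb_id implybb.
  apply/all_pred1P; rewrite all_map all_filter; apply/allP => y _ /=.
  by rewrite eqbF_neg implybb.
- move=> y; rewrite -(perm_mem perm_c); have /permP cE := perm_c.
  by rewrite -!(cE (e _)); apply: x_max.
Qed.

Hypothesis no4 : ~ pack e 4.
Hypothesis p3 : pack e 3.
Hypothesis e_diam : forall u v, u != v -> ~~ e u v -> exists z, e z u && e z v.

Lemma classification : exists n c, 0 < n <= 10 /\ realizes n c.
Proof.
have [c0 c0_tr size_c0] := few_twin_classes e_sym e_irr no4 e_diam p3.
have [c [d [c_tr c_size d_lt c_rows c_max]]] := transversal_head c0_tr.
have k_ok : 0 < size c <= 5 by rewrite (leq_trans _ d_lt) // c_size.
have HE i j := @adj_rows _ e x0 c i j e_sym.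
have no4' : ~~ cpack (adj (rows e c)) (map (class_type e) c) 4.
  by apply/negP => /(packE e_sym e_irr c_tr HE).
have p3' : cpack (adj (rows e c)) (map (class_type e) c) 3.
  exact/(packE e_sym e_irr c_tr HE).
have red := transversal_creduced e_sym e_irr c_tr HE.
have diam := diam2_cdiam2 e_sym e_irr c_tr HE e_diam.
have /allP/(_ (size c)) := complete_checkT; rewrite mem_iota => /(_ k_ok).
rewrite /complete_check allbE => /allP/(_ d).
rewrite mem_iota add0n d_lt => /(_ isT); rewrite allbE => /allP/(_ (rows e (behead c))).
rewrite -[X in graphs X]size_behead rows_graphs -c_rows => /(_ isT).
have HdegE i : i < size c ->
    degree (adj (rows e c)) (size c) i = count (e (nth x0 c i)) c.
  move=> ic; rewrite /degree -[X in _ = count _ X](mkseq_nth x0 c) /mkseq count_map.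
  apply: eq_in_count => j; rewrite mem_iota => jc /=.
  have [->|ij] := eqVneq i j; last exact: HE.
  rewrite e_irr; elim: (rows e c) j {jc} => [|g0 g IHg] [|j] //=; exact: IHg.
rewrite ifN; last first.
  rewrite negbK allbE; apply/allP => i; rewrite mem_iota => ic.
  rewrite (HdegE i ic) HdegE; last by case/andP: k_ok.
  by apply: c_max; apply: mem_nth.
have := cdiam2_nseq (adj_sym _) diam; rewrite size_map => ->.
rewrite -[X in search _ _ X](size_map (class_type e)).
move/(searchP no4' red diam); rewrite p3' anybE.
move=> /hasP[_ /mapP[n n_in ->] /=]; rewrite anybE => /hasP[p].
move: n_in; rewrite mem_filter mem_iota => /andP[/eqP n_size n_ok].
rewrite mem_filter mem_permutations => /andP[p_match p_perm] p_types.
(* The permutation [p] found by the check puts the representatives in the order of the template. *)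
exists n, [seq nth x0 c i | i <- p]; split; first exact: n_ok.
have p_size : size p = size c by rewrite (perm_size p_perm) size_iota.
have lt_p i : i < size c -> nth 0 p i < size c.
  by rewrite -{1}p_size => /(mem_nth 0); rewrite (perm_mem p_perm) mem_iota.
split.
- apply: perm_twin_transversal c_tr; rewrite -{1}(mkseq_nth x0 c).
  by rewrite perm_sym; apply: perm_map.
- by rewrite size_map p_size n_size.
- move=> i j ik jk; move: p_match; rewrite /matches allbE => /allP/(_ i).
  rewrite mem_iota => /(_ ik); rewrite allbE => /allP/(_ j); rewrite mem_iota.
  move=> /(_ jk) /eqP <-; rewrite n_size in ik jk; rewrite !(nth_map 0) ?p_size //.
  have [->|ij] := eqVneq (nth 0 p i) (nth 0 p j); last by rewrite HE ?lt_p.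
  by rewrite e_irr; elim: (rows e c) (nth 0 p j) => [|g0 g IHg] [|m] //=; exact: IHg.
- rewrite -map_comp.
  rewrite (_ : map _ p = [seq nth None (map (class_type e) c) i | i <- p]) //.
  apply/eq_in_map => i; rewrite (perm_mem p_perm) mem_iota => ic /=.
  by rewrite (nth_map x0).
Qed.

End Realization.

(** * The ten structures *)

Section Structures.
Variables (T : finType) (e : rel T) (x0 : T).
Hypotheses (e_sym : symmetric e) (e_irr : irreflexive e).
Notation twin := (twin_eq e).

Lemma twin_adjE x y :
  twin_adj e (twin_class e x) (twin_class e y) = ~~ twin x y && e x y.
Proof.
rewrite /twin_adj twin_classE //; case: (boolP (twin x y)) => //= nxy.
apply/exists_inP/idP => [[u ux /exists_inP[v vy euv]]|exy].
  rewrite !inE in ux vy; have xv : x != v by apply: contraNneq nxy => ->.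
  have uv : u != v by apply: contraTneq euv => ->; rewrite e_irr.
  have uy : u != y by apply: contraNneq nxy => <-; rewrite twin_sym.
  have xy : x != y by apply: contraNneq nxy => ->; apply: twin_refl.
  have /(twinP e_sym e_irr) ux' := ux; have /(twinP e_sym e_irr) vy' := vy.
  by rewrite -vy' // e_sym -ux' 1?eq_sym // e_sym.
exists x; first by rewrite inE twin_refl.
by apply/exists_inP; exists y => //; rewrite inE twin_refl.
Qed.

(** An isomorphism from the template is the same as an ordered transversal: choose a vertex in each
    class, or take the class of each vertex. Only the type condition [Q] then differs between the
    ten structures. *)
Lemma structP n (Q : ('I_(template_order n) -> {set T}) -> Prop) :
  (forall (phi : 'I_(template_order n) -> {set T}) t,
     (forall i, typ1 (phi i) = is1 t i) ->
     (forall i, typK e (phi i) = isK t i) ->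
     (forall i, typN e (phi i) = isN t i) -> Q phi <-> template_types n t) ->
  (exists phi, twin_iso e (tmpl (template_edges n)) phi /\ Q phi) <->
  exists c, realizes e x0 n c.
Proof.
move=> QP; split=> [[phi [[phi_inj phi_im phi_adj] Qphi]]|[c [c_tr c_size cE c_types]]].
  pose f i := odflt x0 [pick v | phi i == twin_class e v].
  have fE i : phi i = twin_class e (f i).
    rewrite /f; case: pickP => [v /eqP//|nv].
    have : phi i \in twin_vertices e by rewrite -phi_im imset_f.
    by case/imsetP => v _ phi_v; have := nv v; rewrite phi_v eqxx.
  have f_twin i j : twin (f i) (f j) = (i == j).
    rewrite -twin_classE // -!fE; apply/eqP/eqP => [/phi_inj//|->//].
  pose c := [seq f i | i <- enum 'I_(template_order n)].
  have c_size : size c = template_order n by rewrite size_map size_enum_ord.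
  have cE (i : 'I_(template_order n)) : nth x0 c i = f i.
    by rewrite (nth_map i) ?size_enum_ord // nth_ord_enum.
  have c_tr : twin_transversal e c.
    split.
    - rewrite map_inj_uniq ?enum_uniq // => i j fij.
      by apply/eqP; rewrite -f_twin fij twin_refl.
    - move=> _ _ /mapP[i _ ->] /mapP[j _ ->] fij; rewrite f_twin.
      by apply: contraNneq fij => ->.
    - apply/coversP => v; have : twin_class e v \in twin_vertices e by apply: imset_f.
      rewrite -phi_im => /imsetP[i _ vi]; exists (f i).
        by rewrite map_f ?mem_enum.
      by rewrite -twin_classE // -fE vi.
  exists c; split=> //.
    move=> i j i_lt j_lt; have := phi_adj (Ordinal i_lt) (Ordinal j_lt).
    rewrite (cE (Ordinal i_lt)) (cE (Ordinal j_lt)) /tmpl /template_adj /= => ->.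
    rewrite !fE twin_adjE f_twin; have [->|//] := eqVneq (Ordinal i_lt) (Ordinal j_lt).
    by rewrite e_irr.
  suff [+ _] : Q phi <-> template_types n (map (class_type e) c) by apply.
  apply: (QP phi (map (class_type e) c)) => i; rewrite fE ?typ1E ?typKE ?typNE //;
    by rewrite /is1 /isK /isN (nth_map x0) ?c_size // cE.
pose phi (i : 'I_(template_order n)) := twin_class e (nth x0 c i).
have [c_uniq c_tw /coversP c_cov] := c_tr.
have lt_c (i : 'I_(template_order n)) : i < size c by rewrite c_size.
have c_twin (i j : 'I_(template_order n)) : twin (nth x0 c i) (nth x0 c j) = (i == j).
  apply/idP/eqP => [|->]; last exact: twin_refl.
  apply: contraTeq => ij; apply: c_tw; rewrite ?mem_nth ?lt_c //.
  by rewrite nth_uniq ?lt_c.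
exists phi; split.
  split.
  - by move=> i j /eqP; rewrite twin_classE // c_twin => /eqP.
  - apply/setP => A; apply/imsetP/imsetP => [[i _ ->]|[v _ ->]].
      by exists (nth x0 c i).
    have [x xc vx] := c_cov v.
    have x_lt : index x c < template_order n by rewrite -c_size index_mem.
    exists (Ordinal x_lt) => //; apply/eqP.
    by rewrite twin_classE //= nth_index.
  - move=> i j; rewrite twin_adjE c_twin -cE //.
    have [->|//] := eqVneq i j.
    by rewrite -[tmpl _ j j]/(template_adj n j j) cE // e_irr.
suff [_] : Q phi <-> template_types n (map (class_type e) c) by apply.
apply: (QP phi (map (class_type e) c)) => i; rewrite ?typ1E ?typKE ?typNE //;
  by rewrite /is1 /isK /isN (nth_map x0).
Qed.

Lemma ord_allP k (P : pred nat) : (forall i : 'I_k, P i) <-> all P (iota 0 k).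
Proof.
split=> [Pk|/allP Pk i]; last by apply: Pk; rewrite mem_iota ltn_ord.
by apply/allP => i; rewrite mem_iota => ik; apply: (Pk (Ordinal ik)).
Qed.

Lemma struct_G1P : struct_G1 e <-> exists c, realizes e x0 1 c.
Proof.
apply: (@structP 1) => phi t h1 hK hN.
suff -> : #|[set i | typ1K e (phi i)]| = count (is1K t) (iota 0 3) by [].
rewrite -sum1_card big_mkcond !big_ord_recl big_ord0 !inE /typ1K !h1 !hK /= /is1K.
by do 3!case: (_ || _).
Qed.

Lemma struct_G2P : struct_G2 e <-> exists c, realizes e x0 2 c.
Proof.
apply: (@structP 2) => phi t h1 hK hN; rewrite /typKN !(h1, hK, hN) !inordK //.
rewrite /= -/(isKN t 2); split.
  by case=> [[-> ->]|[-> ->]]; rewrite ?orbT.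
by move/orP => [] /andP; [left|right].
Qed.

Lemma struct_G3P : struct_G3 e <-> exists c, realizes e x0 3 c.
Proof.
apply: (@structP 3) => phi t h1 hK hN.
rewrite /typ1K /typ1N !(h1, hK, hN) !inordK //= -/(is1K t 2) -/(is1N t 3).
split=> [[-> -> -> H]|/and4P[-> -> -> /implyP H]] /=.
  by apply/implyP => /H[-> ->].
by split=> // /H/andP.
Qed.

Lemma struct_G4P : struct_G4 e <-> exists c, realizes e x0 4 c.
Proof.
apply: (@structP 4) => phi t h1 hK hN; split=> [H|/ord_allP H i].
  by apply/ord_allP => i; rewrite -h1.
by rewrite h1; apply: H.
Qed.

Lemma struct_G5P : struct_G5 e <-> exists c, realizes e x0 5 c.
Proof.
apply: (@structP 5) => phi t h1 hK hN.
rewrite /typ1K !(h1, hK) !inordK //= -!/(is1K t _).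
by split=> [[-> -> -> -> ->]|/and5P[]].
Qed.

Lemma struct_G6P : struct_G6 e <-> exists c, realizes e x0 6 c.
Proof.
apply: (@structP 6) => phi t h1 hK hN; rewrite /template_types; split.
  case=> H1 H2 H3; apply/and3P; split.
  - apply/allP => i; rewrite mem_iota => /andP[i0 i5].
    have := H1 (Ordinal i5); rewrite /typ1K h1 hK; apply.
    by rewrite -val_eqE /= inordK // -lt0n.
  - apply/ord_allP => i; apply/ord_allP => j; apply/implyP => /andP[ij nij].
    by have := H2 i j ij nij; rewrite !hK.
  - apply/ord_allP => i; apply/ord_allP => j; apply/implyP => ij.
    by have := H3 i j ij; rewrite hK hN.
case/and3P => /allP H1 /ord_allP H2 /ord_allP H3; split.
- move=> i i0; rewrite /typ1K h1 hK; apply: H1; rewrite mem_iota ltn_ord andbT lt0n.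
  by apply: contraNneq i0 => i0; apply/eqP/val_inj; rewrite /= inordK.
- move=> i j ij nij; rewrite !hK; have /ord_allP/(_ j) := H2 i.
  by move/implyP; apply; rewrite nij andbT.
- by move=> i j ij; rewrite hK hN; have /ord_allP/(_ j)/implyP := H3 i; apply.
Qed.

Lemma struct_G7P : struct_G7 e <-> exists c, realizes e x0 7 c.
Proof.
apply: (@structP 7) => phi t h1 hK hN.
rewrite /typ1K !(h1, hK) !inordK //= -!/(is1K t _).
by split=> [[-> -> -> -> ->]|/and5P[]].
Qed.

Lemma struct_G8P : struct_G8 e <-> exists c, realizes e x0 8 c.
Proof.
apply: (@structP 8) => phi t h1 hK hN.
rewrite /typ1K !(h1, hK, hN) !inordK //= -!/(is1K t _).
by split=> [[-> -> -> ->]|/and4P[]].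
Qed.

Lemma struct_G9P : struct_G9 e <-> exists c, realizes e x0 9 c.
Proof.
apply: (@structP 9) => phi t h1 hK hN; rewrite !(h1, hK) !inordK //=.
by split=> [[-> -> -> ->]|/and4P[]].
Qed.

Lemma struct_G10P : struct_G10 e <-> exists c, realizes e x0 10 c.
Proof.
apply: (@structP 10) => phi t h1 hK hN.
rewrite /typ1K !(h1, hK) !inordK //= -!/(is1K t _).
by split=> [[-> -> -> -> ->]|/and5P[]].
Qed.

End Structures.

(** * Metric dimension in diameter two *)

Lemma bigmin_le (I : eqType) (r : seq I) (P : pred I) (F : I -> nat) m i :
  i \in r -> P i -> \big[minn/m]_(j <- r | P j) F j <= F i.
Proof.
elim: r => //= j r IHr; rewrite inE big_cons => /orP[/eqP<- ->|ir Pi].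
  exact: geq_minl.
by have := IHr ir Pi; case: ifP => // _; apply: leq_trans; apply: geq_minr.
Qed.

Lemma resolving_setT (T : finType) (e : rel T) : 0 < #|T| -> resolving e setT.
Proof.
move=> T_gt0; apply/forallP => u; apply/forallP => v; apply/implyP.
move/forall_inP/(_ u (in_setT u))/eqP; rewrite /dist; case: #|T| T_gt0 => // n _ /=.
by rewrite !inE eqxx /=; case: eqP => // ->.
Qed.

Lemma metric_dim_le (T : finType) (e : rel T) m : 0 < #|T| ->
  metric_dim e <= m <-> exists2 W : {set T}, resolving e W & #|W| <= m.
Proof.
move=> T_gt0; split=> [le_m|[W W_res leW]]; last first.
  by apply: leq_trans leW; apply: bigmin_le W_res; rewrite mem_index_enum.
suff [W W_res W_dim] : exists2 W : {set T}, resolving e W & #|W| = metric_dim e.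
  by exists W; rewrite ?W_dim.
rewrite /metric_dim; elim/big_ind: _ => [|m1 m2 H1 H2|W W_res].
(* The default value [#|T|] of the minimum is attained by the full vertex set. *)
- by exists setT; rewrite ?cardsT ?resolving_setT.
- by rewrite /minn; case: ifP.
- by exists W.
Qed.

Section Diameter2.
Variables (T : finType) (e : rel T).
Hypotheses (e_sym : symmetric e) (e_irr : irreflexive e).
Hypothesis e_conn : forall u v : T, connect e u v.
Hypothesis e_diam : diameter e = 2.

Lemma dist_le2 u v : dist e u v <= 2.
Proof. by rewrite -e_diam; apply: (@leq_bigmax _ (fun p => dist e p.1 p.2) (u, v)). Qed.

Lemma ball0 u v : (v \in ball e 0 u) = (u == v).
Proof. by rewrite inE eq_sym. Qed.

Lemma ball1 u v : (v \in ball e 1 u) = (u == v) || e u v.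
Proof.
rewrite /= !inE eq_sym; congr (_ || _).
apply/exists_inP/idP => [[x]|uv]; first by rewrite inE => /eqP->.
by exists u; rewrite ?inE.
Qed.

(** [dist] only tries radii below [#|T|], so with fewer than three vertices the value 2 could merely
    mean a failed search. A pair at [dist] above 1 and the next vertex on a path joining it give
    three vertices. *)
Lemma card_gt2 : 2 < #|T|.
Proof.
have [u [v uv]] : exists u v, 1 < dist e u v.
  apply/'exists_existsP; apply: contraPT e_diam => /existsPn nd.
  have : diameter e <= 1.
    by apply/bigmax_leqP => -[u v] _ /=; have /existsPn/(_ v) := nd u; rewrite -leqNgt.
  by case: diameter => [|[|]].
have n2 : 1 < #|T|.
  by apply: leq_trans uv _; rewrite -[X in _ <= X](size_iota 0) find_size.
have [nuv euv] : u != v /\ ~~ e u v.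
  move: uv; rewrite /dist; case: #|T| n2 => [|[|n]] // _.
  rewrite -[iota _ _]/[:: 0, 1 & iota 2 n] /find -/find ball0 ball1.
  by case: eqP => //= _; case: (e u v).
have [p] := connectP (e_conn u v).
case: p => [_ vu|w p /= /andP[uw _] _]; first by rewrite vu eqxx in nuv.
have wu : w != u by apply: contraTneq uw => ->; rewrite e_irr.
have wv : w != v by apply: contraNneq euv => <-.
have: uniq [:: u; v; w] by rewrite /= !inE negb_or nuv ![_ == w]eq_sym wu wv.
by move/card_uniqP => /= <-; apply: max_card.
Qed.

Lemma distE u v : dist e u v = if u == v then 0 else if e u v then 1 else 2.
Proof.
have := dist_le2 u v; rewrite /dist; case: #|T| card_gt2 => [|[|[|n]]] // _.
rewrite -[iota _ _]/[:: 0, 1, 2 & iota 3 n] /find -/find ball0 ball1.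
by case: eqP => //= _; case: (e u v) => //; case: ifP.
Qed.

Lemma common_nbr u v : u != v -> ~~ e u v -> exists z, e z u && e z v.
Proof.
move=> uv nuv; have := dist_le2 u v; rewrite /dist.
case: #|T| card_gt2 => [|[|[|n]]] // _.
rewrite -[iota _ _]/[:: 0, 1, 2 & iota 3 n] /find -/find ball0 ball1.
rewrite (negbTE uv) (negbTE nuv).
have [|//] := boolP (v \in ball e 2 u).
rewrite -[ball e 2 u]/(ball e 1 u :|: _) inE ball1.
rewrite (negbTE uv) (negbTE nuv) inE => /exists_inP[z]; rewrite ball1.
by case/orP => [/eqP<-|uz zv _]; [rewrite (negbTE nuv) | exists z; rewrite e_sym uz].
Qed.

(** A vertex of the resolving set is recognised by its own distance 0, so only pairs in the
    complement matter, and for them distances 1 and 2 encode adjacency. A larger complement may be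
    cut down to [s] vertices, which only adds separators. *)
Lemma metric_dim_pack s : s <= #|T| ->
  metric_dim e <= #|T| - s <-> pack e s.
Proof.
move=> sT; rewrite metric_dim_le; last exact: leq_trans card_gt2.
split=> [[W /forallP W_res leW]|[S S_size S_good]].
  have leU : s <= size (enum (~: W)).
    by rewrite -cardE cardsCs setCK -(subKn sT) leq_sub2l.
  exists (take s (enum (~: W))); first by rewrite size_takel.
  have inU x : x \in take s (enum (~: W)) -> x \notin W.
    by move/mem_take; rewrite mem_enum inE.
  apply: pairwise_in => [|u v uS vS uv]; first by rewrite take_uniq ?enum_uniq.
  have /forallP/(_ v) := W_res u; rewrite (negbTE uv) implybF negb_forall_in.
  case/exists_inP => w wW; rewrite !distE.
  have wN x : x \in take s (enum (~: W)) -> x != w by move/inU; apply: contraNneq => ->.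
  rewrite !(negbTE (wN _ _)) // => duw; apply: (@sepI _ _ _ _ _ w).
    by apply/negP => /inU; rewrite wW.
  by move: duw; rewrite ![e w _]e_sym; case: (e u w); case: (e v w).
have S_uniq := good_uniq S_good.
exists (~: [set x in S]); last first.
  by rewrite cardsCs setCK cardsE (card_uniqP S_uniq) S_size.
apply/forallP => u; apply/forallP => v; apply/implyP => /forall_inP H.
have {}H w : w \notin S -> dist e u w = dist e v w.
  by move=> wS; apply/eqP/H; rewrite !inE.
apply/negPn/negP => uv.
have out x y : x != y -> x \notin S -> dist e x x != dist e y x.
  by move=> xy _; rewrite !distE eqxx [y == x]eq_sym (negbTE xy); case: (e y x).
have uS : u \in S.
  by apply/negPn/negP => uS; move: (out u v uv uS); rewrite H ?eqxx.
have vS : v \in S.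
  apply/negPn/negP => vS; rewrite eq_sym in uv.
  by move: (out v u uv vS); rewrite H ?eqxx.
have /existsP[w /andP[wS]] := in_pairwise (@sep_sym _ _ _) S_good uS vS uv.
have wN x : x \in S -> x != w by apply: contraTneq => ->.
have := H w wS; rewrite !distE !(negbTE (wN _ _)) // ![e w _]e_sym.
by case: (e u w); case: (e v w).
Qed.

End Diameter2.

Theorem theorem3p1 (T : finType) (e : rel T)
  (e_sym : symmetric e) (e_irr : irreflexive e)
  (e_conn : forall u v : T, connect e u v)
  (e_diam : diameter e = 2) :
  metric_dim e = #|T| - 3 <->
  (struct_G1 e \/ struct_G2 e \/ struct_G3 e \/ struct_G4 e \/ struct_G5 e \/
   struct_G6 e \/ struct_G7 e \/ struct_G8 e \/ struct_G9 e \/ struct_G10 e).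
Proof.
have T3 := card_gt2 e_irr e_conn e_diam.
have x0 : T by move: T3; case: (pickP T) => [x _ _|/eq_card0->]; [exact: x | ].
have dimE := metric_dim_pack e_sym e_irr e_conn e_diam.
have -> : metric_dim e = #|T| - 3 <-> pack e 3 /\ ~ pack e 4.
  rewrite -(dimE 3 T3); split=> [dim3|[dim3 no4]].
    split=> [|p4]; first by rewrite dim3.
    (* Subtraction is truncated; with four vertices [#|T| - 4] is strictly below [#|T| - 3]. *)
    have T4 : 4 <= #|T| by case: p4 => S <- /good_uniq/card_uniqP <-; apply: max_card.
    by move/(dimE 4 T4): p4; rewrite dim3 leqNgt ltn_sub2l.
  apply/eqP; rewrite eqn_leq dim3 leqNgt; apply/negP => lt3; apply: no4.
  have T4 : 4 <= #|T| by rewrite -subn_gt0; apply: leq_ltn_trans lt3.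
  by apply/(dimE 4 T4); rewrite -ltnS -subSn.
rewrite !(struct_G1P x0, struct_G2P x0, struct_G3P x0, struct_G4P x0, struct_G5P x0,
  struct_G6P x0, struct_G7P x0, struct_G8P x0, struct_G9P x0, struct_G10P x0) //.
split=> [[p3 no4]|H].
  have [n [c [n_ok c_n]]] :=
    classification x0 e_sym e_irr no4 p3 (common_nbr e_sym e_irr e_conn e_diam).
  case: n n_ok c_n => [|[|[|[|[|[|[|[|[|[|[|]]]]]]]]]]] // _ c_n;
    intuition (exists c; done).
suff [n [c [n_ok c_n]]] : exists n c, 0 < n <= 10 /\ realizes e x0 n c.
  exact: realizes_pack n_ok c_n.
by move: H => [|[|[|[|[|[|[|[|[|]]]]]]]]] [c c_n]; match type of c_n with
  realizes _ _ ?n _ => exists n, c end.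
Qed.
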